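(* Let $\mathbf{A},\mathbf{B}$ be independent $N\times N$ real Ginibre matrices (all entries independent standard Gaussians, density $\frac{1}{\sqrt{2\pi}}e^{-x^2/2}$) and let $\mathbf{Y}=\mathbf{A}^{-1}\mathbf{B}$. The probability density function of $\mathbf{Y}$ (with respect to Lebesgue measure on the $N^2$ entries) is $$\mathcal{P}(\mathbf{Y})=\pi^{-N^2/2}\prod_{j=0}^{N-1}\frac{\Gamma((N+1)/2+j/2)}{\Gamma((j+1)/2)}\;\det(\mathbf{1}_N+\mathbf{Y}\mathbf{Y}^T)^{-N}.$$
   Context: $\mathbf{A}$ is almost surely invertible, so $\mathbf{Y}$ is defined almost surely. $\mathbf{1}_N$ is the $N\times N$ identity matrix. *)

(* Defs.v *)
From HB Require Import structures.
From mathcomp Require Import all_boot all_order all_algebra.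
From mathcomp Require Import all_classical all_reals all_analysis.
Set Implicit Arguments.
Unset Strict Implicit.
Unset Printing Implicit Defensive.
Import Order.TTheory GRing.Theory Num.Theory.
Import numFieldNormedType.Exports.
Local Open Scope classical_set_scope.
Local Open Scope ring_scope.

(* The sigma-algebra on matrices is the one generated by the m * n entry maps;
   for real entries this is the Borel sigma-algebra. *)
Definition mx_display : measure_display -> measure_display.
Proof. exact. Qed.

Section measurable_matrix.
Context {d} {T : measurableType d} (m n : nat).

Definition mx_entry_sets : set (set 'M[T]_(m, n)) :=
  \bigcup_(k in [set: 'I_m * 'I_n])
    preimage_set_system setT (fun M : 'M[T]_(m, n) => M k.1 k.2) measurable.

Let mx_set0 : <<s mx_entry_sets >> set0.
Proof. exact: sigma_algebra0. Qed.

Let mx_setC A : <<s mx_entry_sets >> A -> <<s mx_entry_sets >> (~` A).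
Proof. exact: sigma_algebraC. Qed.

Let mx_bigcup (F : (set 'M[T]_(m, n))^nat) :
  (forall i, <<s mx_entry_sets >> (F i)) -> <<s mx_entry_sets >> (\bigcup_i F i).
Proof. exact: sigma_algebra_bigcup. Qed.

HB.instance Definition _ := @isMeasurable.Build (mx_display d)
  'M[T]_(m, n) <<s mx_entry_sets >> mx_set0 mx_setC mx_bigcup.

End measurable_matrix.

Lemma measurable_mx_entry d (T : measurableType d) m n (i : 'I_m) (j : 'I_n) :
  measurable_fun [set: 'M[T]_(m, n)] (fun M : 'M[T]_(m, n) => M i j).
Proof.
move=> _ Y mY; rewrite setTI; apply: sub_sigma_algebra.
by exists (i, j) => //; exists Y => //; rewrite setTI.
Qed.

Lemma measurable_fun_mxP d d' (S : measurableType d) (T : measurableType d')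
    m n (f : S -> 'M[T]_(m, n)) :
  measurable_fun setT f <-> forall i j, measurable_fun setT (fun x => f x i j).
Proof.
split=> [mf i j|mf].
  exact: (measurableT_comp (@measurable_mx_entry _ T m n i j) mf).
suff h : <<s @mx_entry_sets _ T m n >> `<=` [set A | measurable (f @^-1` A)].
  by move=> _ A mA; rewrite setTI; exact: h.
apply: smallest_sub.
- split => [|B|F mF] /=.
  + by rewrite preimage_set0.
  + by rewrite setTD -preimage_setC; exact: measurableC.
  + by rewrite preimage_bigcup; apply: bigcup_measurable => k _; exact: mF.
- move=> _ [[i j] _ [B mB <-]] /=.
  by have := mf i j measurableT B mB; rewrite !setTI.
Qed.

Lemma pushforward_sigma_finite_measure d d' (S : measurableType d)
    (T : measurableType d') (R : realType)
    (mu : {measure set S -> \bar R}) (f : S -> T) (g : T -> S) :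
  sigma_finite setT mu -> measurable_fun setT f -> measurable_fun setT g -> cancel f g ->
  exists nu : {sigma_finite_measure set T -> \bar R},
    nu = pushforward mu f :> (_ -> _).
Proof.
move=> [F TF mF] mf mg fK.
have [nu nuE] : exists nu, nu = pushforward mu f by exists (pushforward mu f).
have nu0 : nu set0 = 0%E by rewrite nuE measure0.
have nu_ge0 A : (0 <= nu A)%E by rewrite nuE measure_ge0.
have nu_sadd : semi_sigma_additive nu.
  by rewrite nuE; exact: measure_semi_sigma_additive.
have nu_sfin : sigma_finite setT nu.
  exists (fun i => g @^-1` F i); first by rewrite -preimage_bigcup -TF preimage_setT.
  move=> i; have [mFi Fi_fin] := mF i; split.
    by rewrite -[X in measurable X]setTI; exact: mg.
  rewrite nuE /pushforward -comp_preimage (_ : g \o f = id) ?preimage_id//.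
  exact/funext.
pose m := isMeasure.Build _ _ _ nu nu0 nu_ge0 nu_sadd.
pose nuM : {measure set T -> \bar R} := HB.pack nu m.
pose s := Measure_isSigmaFinite.Build _ _ _ nuM nu_sfin.
pose nuS : {sigma_finite_measure set T -> \bar R} := HB.pack nu m s.
by exists nuS.
Qed.

(* The library proves this too, but its canonical instance is masked by the
   later one for products of probabilities. *)
Lemma sigma_finite_product d1 d2 (T1 : measurableType d1)
    (T2 : measurableType d2) (R : realType)
    (m1 : {sigma_finite_measure set T1 -> \bar R})
    (m2 : {sigma_finite_measure set T2 -> \bar R}) :
  sigma_finite setT (m1 \x m2)%E.
Proof.
have /sigma_finiteP[F [TF ndF Foo]] := sigma_finiteT m1.
have /sigma_finiteP[G [TG ndG Goo]] := sigma_finiteT m2.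
exists (fun n => F n `*` G n).
  rewrite -setXTT TF TG predeqE => -[x y]; split.
    move=> [/= [n _ Fnx] [k _ Gky]]; exists (maxn n k) => //; split.
    - by move: x Fnx; exact/subsetPset/ndF/leq_maxl.
    - by move: y Gky; exact/subsetPset/ndG/leq_maxr.
  by move=> [n _ []/= ? ?]; split; exists n.
move=> k; have [? ?] := Foo k; have [? ?] := Goo k.
split; first exact: measurableX.
by rewrite product_measure1E// lte_mul_pinfty// ge0_fin_numE.
Qed.

Section product_power.
Context {d} {T : measurableType d} {R : realType}.
Variable mu : {sigma_finite_measure set T -> \bar R}.

Definition tuple_of_pair n (p : T * n.-tuple T) : n.+1.-tuple T :=
  [tuple of p.1 :: p.2].

Definition pair_of_tuple n (t : n.+1.-tuple T) : T * n.-tuple T :=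
  (thead t, [tuple of behead t]).

Lemma tuple_of_pairK n : cancel (@tuple_of_pair n) (@pair_of_tuple n).
Proof.
by move=> [x t]; rewrite /pair_of_tuple theadE; congr pair; apply: val_inj.
Qed.

Lemma measurable_tuple_of_pair n : measurable_fun setT (@tuple_of_pair n).
Proof. exact: measurable_cons. Qed.

Lemma measurable_pair_of_tuple n : measurable_fun setT (@pair_of_tuple n).
Proof.
exact: (measurable_fun_pair (measurable_tnth ord0) (@measurable_behead _ T n)).
Qed.

Fixpoint product_power n : set (n.-tuple T) -> \bar R :=
  if n is n'.+1 then
    pushforward (mu \x @product_power n')%E (@tuple_of_pair n')
  else \d_[tuple].

Let product_power_sigma_finite_measure n :
  exists nu : {sigma_finite_measure set (n.-tuple T) -> \bar R},
    nu = @product_power n :> (_ -> _).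
Proof.
elim: n => [|n [nu nuE]]; first by exists \d_[tuple].
have [nu' nu'E] := pushforward_sigma_finite_measure
  (sigma_finite_product mu nu)
  (@measurable_tuple_of_pair n)
  (@measurable_pair_of_tuple n) (@tuple_of_pairK n).
by exists nu'; rewrite nu'E /= nuE.
Qed.

Let product_power0 n : @product_power n set0 = 0%E.
Proof.
by have [nu <-] := product_power_sigma_finite_measure n; rewrite measure0.
Qed.

Let product_power_ge0 n A : (0 <= @product_power n A)%E.
Proof. by have [nu <-] := product_power_sigma_finite_measure n. Qed.

Let product_power_semi_sigma_additive n :
  semi_sigma_additive (@product_power n).
Proof.
have [nu <-] := product_power_sigma_finite_measure n.
exact: measure_semi_sigma_additive.
Qed.

HB.instance Definition _ n := isMeasure.Build _ _ _ (@product_power n)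
  (@product_power0 n) (@product_power_ge0 n)
  (@product_power_semi_sigma_additive n).

Let sigma_finite_product_power n : sigma_finite setT (@product_power n).
Proof.
by have [nu <-] := product_power_sigma_finite_measure n; exact: sigma_finiteT.
Qed.

HB.instance Definition _ n := Measure_isSigmaFinite.Build _ _ _
  (@product_power n) (@sigma_finite_product_power n).

Lemma product_powerX n (A : 'I_n -> set T) :
  (forall i, measurable (A i)) ->
  product_power [set t : n.-tuple T | forall i, A i (tnth t i)] =
  (\prod_(i < n) mu (A i))%E.
Proof.
elim: n A => [|n IH] A mA.
  by rewrite big_ord0 /= diracE mem_set// => -[].
rewrite big_ord_recl -IH// -product_measure1E//=; last first.
  rewrite (_ : [set _ | _] = \bigcap_(i in [set: 'I_n])
      ((@tnth n T)^~ i @^-1` A (lift ord0 i))); last first.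
    by apply/seteqP; split=> t /=; [move=> h i _; exact: h|move=> h i; exact: h].
  apply: fin_bigcap_measurable => // i _.
  by rewrite -[X in measurable X]setTI; exact: measurable_tnth.
rewrite /= /pushforward; congr (product_measure1 _ _ _).
apply/seteqP; split => -[x t] /=.
- move=> h; split; first exact: (h ord0).
  by move=> i; have := h (lift ord0 i); rewrite tnthS.
- move=> [Ax At] i; case: (unliftP ord0 i) => [j|] ->; last by [].
  by rewrite tnthS; exact: At.
Qed.

End product_power.

Section lebesgue_mx.
Context {R : realType} (m n : nat).
Local Notation mR := (measurableTypeR R).

Definition mx_of_tuple (t : (m * n).-tuple mR) : 'M[R]_(m, n) :=
  \matrix_(i, j) tnth t (mxvec_index i j).

Definition tuple_of_mx (M : 'M[R]_(m, n)) : (m * n).-tuple mR :=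
  [tuple mxvec M 0 k | k < m * n].

Lemma mx_of_tupleK : cancel mx_of_tuple tuple_of_mx.
Proof.
move=> t; apply: eq_from_tnth => k; rewrite tnth_mktuple.
by case/mxvec_indexP: k => i j; rewrite mxvecE mxE.
Qed.

Lemma measurable_mx_of_tuple : measurable_fun setT mx_of_tuple.
Proof.
apply/measurable_fun_mxP => i j.
rewrite (_ : (fun _ => _) = fun t => tnth t (mxvec_index i j)).
  exact: measurable_tnth.
by apply/funext => t; rewrite mxE.
Qed.

Lemma measurable_tuple_of_mx : measurable_fun setT tuple_of_mx.
Proof.
apply/measurable_fun_tnthP => k; case/mxvec_indexP: k => i j.
rewrite (_ : _ \o _ = fun M : 'M[R]_(m, n) => M i j).
  exact: measurable_mx_entry.
by apply/funext => M; rewrite /= tnth_mktuple mxvecE.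
Qed.

(* Lebesgue measure on the m * n entries; see lebesgue_mxX for its value on
   boxes. *)
Definition lebesgue_mx : set 'M[R]_(m, n) -> \bar R :=
  pushforward (product_power (@lebesgue_measure R) (n := m * n)) mx_of_tuple.

Let lebesgue_mx_sigma_finite_measure :
  exists nu : {sigma_finite_measure set 'M[R]_(m, n) -> \bar R},
    nu = lebesgue_mx :> (_ -> _).
Proof.
exact: (pushforward_sigma_finite_measure
  (sigma_finiteT (product_power (@lebesgue_measure R) (n := m * n)))
  measurable_mx_of_tuple measurable_tuple_of_mx mx_of_tupleK).
Qed.

Let lebesgue_mx0 : lebesgue_mx set0 = 0%E.
Proof. by have [nu <-] := lebesgue_mx_sigma_finite_measure; rewrite measure0. Qed.

Let lebesgue_mx_ge0 A : (0 <= lebesgue_mx A)%E.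
Proof. by have [nu <-] := lebesgue_mx_sigma_finite_measure. Qed.

Let lebesgue_mx_semi_sigma_additive : semi_sigma_additive lebesgue_mx.
Proof.
have [nu <-] := lebesgue_mx_sigma_finite_measure.
exact: measure_semi_sigma_additive.
Qed.

HB.instance Definition _ := isMeasure.Build _ _ _ lebesgue_mx
  lebesgue_mx0 lebesgue_mx_ge0 lebesgue_mx_semi_sigma_additive.

Let sigma_finite_lebesgue_mx : sigma_finite setT lebesgue_mx.
Proof.
by have [nu <-] := lebesgue_mx_sigma_finite_measure; exact: sigma_finiteT.
Qed.

HB.instance Definition _ := Measure_isSigmaFinite.Build _ _ _
  lebesgue_mx sigma_finite_lebesgue_mx.

Lemma lebesgue_mxX (A : 'I_m -> 'I_n -> set R) :
  (forall i j, measurable (A i j)) ->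
  lebesgue_mx [set M | forall i j, A i j (M i j)] =
  (\prod_(i < m) \prod_(j < n) lebesgue_measure (A i j))%E.
Proof.
move=> mA.
pose g (k : 'I_(m * n)) := enum_val (cast_ord (esym (mxvec_cast m n)) k).
have gK i j : g (mxvec_index i j) = (i, j).
  by rewrite /g /mxvec_index cast_ordK enum_rankK.
rewrite pair_big /=.
transitivity (\prod_(k < m * n) lebesgue_measure (A (g k).1 (g k).2))%E.
  rewrite -product_powerX; last by move=> k; exact: mA.
  rewrite /lebesgue_mx /pushforward; congr (product_power _ _).
  apply/seteqP; split => t /= h.
    by case/mxvec_indexP => i j; rewrite gK; have := h i j; rewrite mxE.
  by move=> i j; rewrite mxE; have := h (mxvec_index i j); rewrite gK.
rewrite (reindex (uncurry (@mxvec_index m n))) /=; last first.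
  by exists g => [[i j] _|k _]; [exact: gK|case/mxvec_indexP: k => i j; rewrite gK].
by apply: eq_bigr => -[i j] _; rewrite /= gK.
Qed.

End lebesgue_mx.
Arguments lebesgue_mx {R m n}.

(* Euler's Gamma function; the integral converges for x > 0. *)
Definition Gamma {R : realType} (x : R) : R :=
  (\int[lebesgue_measure]_(t in `]0, +oo[) (t `^ (x - 1) * expR (- t)))%R.

Section random_matrices.
Context {d} {T : measurableType d} {R : realType} (P : probability T R).

Definition mutually_independent d' (T' : measurableType d') (I : finType)
    (X : I -> T -> T') :=
  forall (J : {set I}) (E : I -> set T'),
    (forall i, measurable (E i)) ->
    P (\bigcap_(i in [set` J]) (X i @^-1` E i)) =
    (\prod_(i in J) P (X i @^-1` E i))%E.

Definition independent d1 d2 (T1 : measurableType d1) (T2 : measurableType d2)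
    (X : T -> T1) (Y : T -> T2) :=
  forall (E : set T1) (F : set T2), measurable E -> measurable F ->
    P (X @^-1` E `&` Y @^-1` F) = (P (X @^-1` E) * P (Y @^-1` F))%E.

Definition standard_gaussian (X : T -> R) :=
  forall E : set R, measurable E -> P (X @^-1` E) = normal_prob 0 1 E.

Definition real_ginibre N (A : T -> 'M[R]_N) :=
  (forall i j, standard_gaussian (fun w => A w i j)) /\
  mutually_independent (fun (k : 'I_N * 'I_N) w => A w k.1 k.2).

(* f is a probability density function of X with respect to mu. *)
Definition has_density d' (T' : measurableType d') (X : T -> T')
    (mu : {measure set T' -> \bar R}) (f : T' -> R) :=
  [/\ measurable_fun setT X, measurable_fun setT f, forall x, 0 <= f x &
    forall E, measurable E -> P (X @^-1` E) = (\int[mu]_(x in E) (f x)%:E)%E].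

End random_matrices.

Lemma normal_pdf01 (R : realType) (x : R) :
  normal_pdf 0 1 x = (Num.sqrt (2 * pi))^-1 * expR (- x ^+ 2 / 2).
Proof.
rewrite normal_pdfE ?oner_neq0// /normal_peak /normal_fun.
by rewrite expr1n mul1r subr0 mulr_natl.
Qed.

(* Main.v *)
(** Almost surely [A] is invertible, and for fixed invertible [A] the substitution
    [B = A Y] has Jacobian [|det A|^N].  Hence the density of [Y] is
    [\int |det A|^N phi(A) phi(A Y) dA], [phi] the Gaussian density.  Writing
    [1 + Y Y^T = S S^T] (Cholesky) and substituting [A S] for [A], this becomes
    [(2 pi)^(- N^2 / 2) E|det A|^N det(1 + Y Y^T)^(- N)].

    The Jacobians come from uniqueness of Haar measure: a linear automorphism
    multiplies Lebesgue measure by a constant, and this character of [GL_n] is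
    determined by its values on diagonal matrices.

    For the moment of [|det A|], a Householder reflection sends the first column
    [a] to [|a| e_1], so that [E h(det A_n) = E h(|a|) E h(det A_(n-1))] for every
    multiplicative even [h].  Taking [h(x) = 1] for [x <> 0] shows that [det A <> 0]
    almost surely, and [h(x) = |x|^N] gives a product of radial moments.  These are
    compared with Gamma integrals by applying Tonelli's theorem to
    [v(x) u^(r-1) e^(- (1 + u) q(x))], both for [q(x) = |x|^2 / 2] on [R^n] and for
    [q(t) = t] on the half line: only homogeneity matters, and no polar
    coordinates are needed. *)
Require Import Defs.
From HB Require Import structures.
From mathcomp Require Import all_boot all_order all_algebra.
From mathcomp Require Import all_classical all_reals all_analysis.
From mathcomp Require Import perm measurable_realfun ring lra.
Set Implicit Arguments.
Unset Strict Implicit.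
Unset Printing Implicit Defensive.
Import Order.TTheory GRing.Theory Num.Theory.
Import numFieldNormedType.Exports.
Local Open Scope classical_set_scope.
Local Open Scope ring_scope.

(* These instances take a measurability proof that inference cannot supply, so
   they are applied explicitly. *)
Local Notation pushforward_measure :=
  measure_function_pushforward__canonical__measure_function_Measure (only parsing).
Local Notation mscale_measure :=
  measure_function_mscale__canonical__measure_function_Measure (only parsing).

(** * Measures on matrices *)

Section density_measure.
Context d (T : measurableType d) (R : realType).
Variables (mu : {measure set T -> \bar R}) (f : T -> R).
Hypotheses (mf : measurable_fun setT f) (f0 : forall x, 0 <= f x).

(** Laws given by densities become measures, so that they can be identified by their values on boxes
    or rectangles. *)
Lemma density_measure_exists : exists nu : {measure set T -> \bar R},
  forall E, measurable E -> nu E = (\int[mu]_(x in E) (f x)%:E)%E.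
Proof.
pose g (E : set T) := (\int[mu]_(x in E) (f x)%:E)%E.
have g0 : g set0 = 0%E by rewrite /g integral_set0.
have g_ge0 E : (0 <= g E)%E by apply: integral_ge0 => x _; rewrite lee_fin.
have gs : semi_sigma_additive g.
  move=> F mF tF mUF; rewrite /g ge0_integral_bigcup//.
  - by apply: is_cvg_ereal_nneg_natsum => n _; exact: g_ge0.
  - by apply/measurable_EFinP; exact: measurable_funTS.
  - by move=> x _; rewrite lee_fin.
pose m := isMeasure.Build _ _ _ g g0 g_ge0 gs.
by exists (HB.pack g m : {measure set T -> \bar R}).
Qed.

End density_measure.

Section matrix_measure.
Context {R : realType} (m n : nat).
Implicit Types A : 'I_m -> 'I_n -> set R.

Definition mx_box A : set 'M[R]_(m, n) := [set M | forall i j, A i j (M i j)].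

Lemma measurable_mx_box A : (forall i j, measurable (A i j)) -> measurable (mx_box A).
Proof.
move=> mA; rewrite (_ : mx_box A = \bigcap_(k in [set: 'I_m * 'I_n])
   ((fun M : 'M[R]_(m, n) => M k.1 k.2) @^-1` A k.1 k.2)).
  apply: fin_bigcap_measurable => // k _.
  by rewrite -[X in measurable X]setTI; exact: measurable_mx_entry.
by apply/seteqP; split=> M /= h; [move=> k _; exact: h|move=> i j; exact: (h (i, j))].
Qed.

(** Boxes are stable under intersection and generate the sigma-algebra, and the cubes of half-side
    [k] exhaust the space. Finiteness on these cubes therefore suffices for the uniqueness theorem
    for measures. *)
Lemma measure_mx_unique (m1 m2 : {measure set 'M[R]_(m, n) -> \bar R}) :
  (forall A, (forall i j, measurable (A i j)) -> m1 (mx_box A) = m2 (mx_box A)) ->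
  (forall k : nat, m1 (mx_box (fun _ _ => [set` `[- k%:R, k%:R]%R])) < +oo)%E ->
  forall E, measurable E -> m1 E = m2 E.
Proof.
move=> m12 moo E mE.
pose G := [set X : set 'M[R]_(m, n) | exists2 A, (forall i j, measurable (A i j)) & X = mx_box A].
apply: (measure_unique G (fun k : nat => mx_box (fun _ _ => [set` `[- k%:R, k%:R]%R]))) => //.
- apply/seteqP; split.
  + apply: smallest_sub; first exact: smallest_sigma_algebra.
    move=> _ [[i j] _ [B mB <-]]; apply: sub_sigma_algebra => /=.
    (* A generator constrains one entry only, so all other sides of the box are full. *)
    exists (fun i' j' => if (i' == i) && (j' == j) then B else setT).
      by move=> i' j'; case: ifP.
    rewrite setTI; apply/seteqP; split => M /=; last by move/(_ i j); rewrite !eqxx.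
    by move=> h i' j'; case: ifPn => // /andP[/eqP -> /eqP ->].
  + apply: smallest_sub; first by split=> [|B|F mF];
      [exact: measurable0|rewrite setTD; exact: measurableC|exact: bigcupT_measurable].
    by move=> _ [A mA ->]; exact: measurable_mx_box.
- move=> _ _ [A mA ->] [B mB ->]; exists (fun i j => A i j `&` B i j).
    by move=> i j; exact: measurableI.
  apply/seteqP; split => M /=.
    by move=> [h1 h2] i j; split.
  by move=> h; split=> i j; have [] := h i j.
- by move=> k; exists (fun _ _ => [set` `[- k%:R, k%:R]%R]).
- apply/seteqP; split => // M _.
  have [k hk] : exists k : nat, forall i j, `|M i j| <= k%:R.
    exists (\max_(p : 'I_m * 'I_n) (Num.truncn `|M p.1 p.2|).+1)%N => i j.
    apply: (@le_trans _ _ (Num.truncn `|M i j|).+1%:R).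
      by rewrite ltW// truncnS_gt.
    by rewrite ler_nat; exact: (leq_bigmax (i, j)).
  by exists k => // i j; rewrite /= in_itv /= -ler_norml.
- by move=> _ [A mA ->]; exact: m12.
Qed.

Lemma lebesgue_mx_box A : (forall i j, measurable (A i j)) ->
  (lebesgue_mx (mx_box A) = \prod_(i < m) \prod_(j < n) lebesgue_measure (A i j))%E.
Proof. exact: lebesgue_mxX. Qed.

Lemma lebesgue_mx_unique (mu : {measure set 'M[R]_(m, n) -> \bar R}) :
  (forall A, (forall i j, measurable (A i j)) ->
    mu (mx_box A) = \prod_(i < m) \prod_(j < n) lebesgue_measure (A i j))%E ->
  forall E, measurable E -> lebesgue_mx E = mu E.
Proof.
move=> h; apply: measure_mx_unique => [A mA|k]; first by rewrite h//= lebesgue_mx_box.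
rewrite /= lebesgue_mx_box; last by move=> i j; exact: measurable_itv.
under eq_bigr do under eq_bigr do rewrite lebesgue_measure_itv/=.
rewrite ltey_eq; apply/orP; left.
apply: prode_fin_num => i _; apply: prode_fin_num => j _.
by case: ifP => //; rewrite -EFinB.
Qed.

End matrix_measure.

(** * Integration over blocks and over products of entries *)

Section ge0_integral.
Context d1 d2 (T1 : measurableType d1) (T2 : measurableType d2) (R : realType).

(* The canonical measure structure on a product of sigma-finite measures is
   masked by the one for probabilities, hence the explicit measure [nu]. *)
Lemma ge0_integral_pushforward_product d (T : measurableType d)
    (m1 : {sigma_finite_measure set T1 -> \bar R})
    (m2 : {sigma_finite_measure set T2 -> \bar R})
    (phi : T1 * T2 -> T) (mu : {measure set T -> \bar R}) (f : T -> \bar R) :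
  measurable_fun setT phi ->
  (forall nu : {measure set T -> \bar R},
     nu = pushforward (m1 \x m2)%E phi :> (_ -> _) ->
     forall E, measurable E -> mu E = nu E) ->
  measurable_fun setT f -> (forall x, 0 <= f x)%E ->
  (\int[mu]_x f x = \int[m1]_x \int[m2]_y f (phi (x, y)))%E.
Proof.
move=> mphi munu mf f0.
pose m12 : {measure set (T1 * T2) -> \bar R} := Measure.clone _ _ _ (m1 \x m2)%E _.
have [nu nuE] : exists nu : {measure set T -> \bar R}, nu = pushforward m12 phi :> (_ -> _).
  by exists (pushforward_measure m12 mphi).
rewrite (eq_measure_integral nu); last by move=> A mA _; exact: munu.
rewrite nuE.
rewrite ge0_integral_pushforward//.
rewrite preimage_setT -(fubini_tonelli1 (f \o phi))//.
  exact: measurableT_comp.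
by move=> x; exact: f0.
Qed.

End ge0_integral.

Section block_integral.
Context {R : realType}.

Lemma measurable_row_mx d (S : measurableType d) m n1 n2
    (f : S -> 'M[R]_(m, n1)) (g : S -> 'M[R]_(m, n2)) :
  measurable_fun setT f -> measurable_fun setT g ->
  measurable_fun setT (fun x => row_mx (f x) (g x)).
Proof.
move=> /measurable_fun_mxP mf /measurable_fun_mxP mg; apply/measurable_fun_mxP => i j.
case: (split_ordP j) => k ->; first by under eq_fun do rewrite row_mxEl; exact: mf.
by under eq_fun do rewrite row_mxEr; exact: mg.
Qed.

Lemma measurable_col_mx d (S : measurableType d) m1 m2 n
    (f : S -> 'M[R]_(m1, n)) (g : S -> 'M[R]_(m2, n)) :
  measurable_fun setT f -> measurable_fun setT g ->
  measurable_fun setT (fun x => col_mx (f x) (g x)).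
Proof.
move=> /measurable_fun_mxP mf /measurable_fun_mxP mg; apply/measurable_fun_mxP => i j.
case: (split_ordP i) => k ->; first by under eq_fun do rewrite col_mxEu; exact: mf.
by under eq_fun do rewrite col_mxEd; exact: mg.
Qed.

(** The preimage of a box under [row_mx] is a product of two boxes, so the image of the product
    measure agrees with Lebesgue measure on boxes; Tonelli's theorem then gives the iterated
    integral. *)
Lemma integral_row_mx m n1 n2 (f : 'M[R]_(m, n1 + n2) -> \bar R) :
  measurable_fun setT f -> (forall x, 0 <= f x)%E ->
  (\int[lebesgue_mx]_X f X =
   \int[lebesgue_mx]_X \int[lebesgue_mx]_Y f (row_mx X Y))%E.
Proof.
move=> mf f0; apply: (ge0_integral_pushforward_product
  (measurable_row_mx measurable_fst measurable_snd) _ mf f0) => nu nuE.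
apply: lebesgue_mx_unique => A mA.
rewrite nuE /pushforward.
rewrite (_ : _ @^-1` _ = mx_box (fun i j => A i (lshift n2 j)) `*`
   mx_box (fun i j => A i (rshift n1 j))); last first.
  apply/seteqP; split => -[X Y] /=.
    by move=> h; split=> i j; [rewrite -(row_mxEl X Y)|rewrite -(row_mxEr X Y)]; exact: h.
  move=> [h1 h2] i j; case: (split_ordP j) => k ->; rewrite ?row_mxEl ?row_mxEr.
  - exact: h1.
  - exact: h2.
rewrite product_measure1E; [|exact: measurable_mx_box..].
rewrite /= !lebesgue_mx_box// -big_split/=.
by apply: eq_bigr => i _; rewrite big_split_ord.
Qed.

Lemma integral_col_mx m1 m2 n (f : 'M[R]_(m1 + m2, n) -> \bar R) :
  measurable_fun setT f -> (forall x, 0 <= f x)%E ->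
  (\int[lebesgue_mx]_X f X =
   \int[lebesgue_mx]_X \int[lebesgue_mx]_Y f (col_mx X Y))%E.
Proof.
move=> mf f0; apply: (ge0_integral_pushforward_product
  (measurable_col_mx measurable_fst measurable_snd) _ mf f0) => nu nuE.
apply: lebesgue_mx_unique => A mA.
rewrite nuE /pushforward.
rewrite (_ : _ @^-1` _ = mx_box (fun i j => A (lshift m2 i) j) `*`
   mx_box (fun i j => A (rshift m1 i) j)); last first.
  apply/seteqP; split => -[X Y] /=.
    by move=> h; split=> i j; [rewrite -(col_mxEu X Y)|rewrite -(col_mxEd X Y)]; exact: h.
  move=> [h1 h2] i j; case: (split_ordP i) => k ->; rewrite ?col_mxEu ?col_mxEd.
  - exact: h1.
  - exact: h2.
rewrite product_measure1E; [|exact: measurable_mx_box..].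
by rewrite /= !lebesgue_mx_box// big_split_ord.
Qed.

End block_integral.

Section product_integral.

(** Tonelli's theorem splits off the first coordinate, and induction handles the others. *)
Lemma integral_product_power d (T : measurableType d) (R : realType)
    (mu : {sigma_finite_measure set T -> \bar R}) n (f : 'I_n -> T -> \bar R) :
  (forall i, measurable_fun setT (f i)) -> (forall i x, 0 <= f i x)%E ->
  (\int[product_power mu (n := n)]_t (\prod_(i < n) f i (tnth t i)) =
   \prod_(i < n) \int[mu]_x f i x)%E.
Proof.
have mprod k (g : 'I_k -> T -> \bar R) : (forall i, measurable_fun setT (g i)) ->
    measurable_fun setT (fun t : k.-tuple T => \prod_(i < k) g i (tnth t i))%E.
  move=> mg; elim: (index_enum _) => [|i s IHs].
    by under eq_fun do rewrite big_nil; exact: measurable_cst.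
  under eq_fun do rewrite big_cons.
  by apply: emeasurable_funM => //; exact: (measurableT_comp (mg i) (measurable_tnth i)).
elim: n f => [|n IH] f mf f0.
  rewrite big_ord0; under eq_integral do rewrite big_ord0.
  by rewrite integral_cst//= probability_setT mule1.
pose g (t : n.+1.-tuple T) := (\prod_(i < n.+1) f i (tnth t i))%E.
have g0 t : (0 <= g t)%E by apply: prode_ge0 => i _; exact: f0.
have mg : measurable_fun setT g by exact: mprod.
apply: etrans.
  apply: (ge0_integral_pushforward_product (m1 := mu)
    (m2 := product_power mu (n := n)) (@measurable_tuple_of_pair _ T n) _ mg g0).
  by move=> nu nuE E _; rewrite nuE.
rewrite big_ord_recl /= -IH//.
have h0 (t : n.-tuple T) : (0 <= \prod_(i < n) f (lift ord0 i) (tnth t i))%E.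
  by apply: prode_ge0.
rewrite -ge0_integralZr//; last by apply: integral_ge0.
apply: eq_integral => x _; rewrite -ge0_integralZl//; last exact: (mprod n (fun i => f (lift ord0 i))).
apply: eq_integral => t _; rewrite /g big_ord_recl; congr (_ * _)%E.
by apply: eq_bigr => i _; rewrite tnthS.
Qed.

Lemma integral_lebesgue_mx_prod (R : realType) m n (f : 'I_m -> 'I_n -> R -> \bar R) :
  (forall i j, measurable_fun setT (f i j)) -> (forall i j x, 0 <= f i j x)%E ->
  (\int[@lebesgue_mx R m n]_M (\prod_(i < m) \prod_(j < n) f i j (M i j)) =
   \prod_(i < m) \prod_(j < n) \int[lebesgue_measure]_x f i j x)%E.
Proof.
move=> mf f0.
(* [g] decodes a flat index into its row and column, which turns the double product into a single
   one over the coordinates of a tuple. *)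
pose g (k : 'I_(m * n)) := enum_val (cast_ord (esym (mxvec_cast m n)) k).
have gK i j : g (mxvec_index i j) = (i, j).
  by rewrite /g /mxvec_index cast_ordK enum_rankK.
have reidx (F : 'I_m -> 'I_n -> \bar R) : (\prod_(i < m) \prod_(j < n) F i j =
    \prod_(k < m * n) F (g k).1 (g k).2)%E.
  rewrite pair_big /= [RHS](reindex (uncurry (@mxvec_index m n))) /=; last first.
    by exists g => [[i j] _|k _]; [exact: gK|case/mxvec_indexP: k => i j; rewrite gK].
  by apply: eq_bigr => -[i j] _; rewrite /= gK.
rewrite reidx -integral_product_power//.
rewrite /lebesgue_mx ge0_integral_pushforward//.
- apply: eq_integral => t _ /=; rewrite reidx; apply: eq_bigr => k _.
  by case/mxvec_indexP: k => i j; rewrite gK mxE.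
- exact: measurable_mx_of_tuple.
- under eq_fun do rewrite reidx.
  elim: (index_enum _) => [|k s IHs].
    by under eq_fun do rewrite big_nil; exact: measurable_cst.
  under eq_fun do rewrite big_cons.
  apply: emeasurable_funM => //.
  exact: (measurableT_comp (mf _ _) (measurable_mx_entry _ _)).
- by move=> M _ /=; do 2 (apply: prode_ge0 => ? _).
- by move=> k; exact: mf.
Qed.

End product_integral.

(** * Haar uniqueness *)

Section measurable_matrix_operations.
Context d (S : measurableType d) (R : realType).

Lemma measurable_addmx m n (f g : S -> 'M[R]_(m, n)) :
  measurable_fun setT f -> measurable_fun setT g ->
  measurable_fun setT (fun x => f x + g x).
Proof.
move=> /measurable_fun_mxP mf /measurable_fun_mxP mg.
apply/measurable_fun_mxP => i j; under eq_fun do rewrite mxE.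
exact: measurable_funD.
Qed.

Lemma measurable_oppmx m n (f : S -> 'M[R]_(m, n)) :
  measurable_fun setT f -> measurable_fun setT (fun x => - f x).
Proof.
move=> /measurable_fun_mxP mf; apply/measurable_fun_mxP => i j.
by under eq_fun do rewrite mxE; exact: measurable_funN.
Qed.

Lemma measurable_trmx m n (f : S -> 'M[R]_(m, n)) :
  measurable_fun setT f -> measurable_fun setT (fun x => (f x)^T).
Proof.
move=> /measurable_fun_mxP mf; apply/measurable_fun_mxP => i j.
by under eq_fun do rewrite mxE; exact: mf.
Qed.

Lemma measurable_mulmx m n p (f : S -> 'M[R]_(m, n)) (g : S -> 'M[R]_(n, p)) :
  measurable_fun setT f -> measurable_fun setT g ->
  measurable_fun setT (fun x => f x *m g x).
Proof.
move=> /measurable_fun_mxP mf /measurable_fun_mxP mg.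
apply/measurable_fun_mxP => i j; under eq_fun do rewrite mxE.
by apply: measurable_sum => k; exact: measurable_funM.
Qed.

Lemma measurable_det n (f : S -> 'M[R]_n) :
  measurable_fun setT f -> measurable_fun setT (fun x => \det (f x)).
Proof.
move=> /measurable_fun_mxP mf; apply: measurable_sum => s.
apply: measurable_funM; first exact: measurable_cst.
by apply: measurable_prod => i _; exact: mf.
Qed.

Lemma measurable_mxtrace n (f : S -> 'M[R]_n) :
  measurable_fun setT f -> measurable_fun setT (fun x => \tr (f x)).
Proof. by move=> /measurable_fun_mxP mf; exact: measurable_sum. Qed.

Lemma measurable_adjmx n (f : S -> 'M[R]_n) :
  measurable_fun setT f -> measurable_fun setT (fun x => \adj (f x)).
Proof.
move=> /measurable_fun_mxP mf; apply/measurable_fun_mxP => i j.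
under eq_fun do rewrite mxE /cofactor.
apply: measurable_funM; first exact: measurable_cst.
apply: measurable_det; apply/measurable_fun_mxP => k l.
by under eq_fun do rewrite !mxE; exact: mf.
Qed.

Lemma measurable_invr (f : S -> R) :
  measurable_fun setT f -> measurable_fun setT (fun x => (f x)^-1).
Proof.
move=> mf.
(* Reduces to the measurability of real powers. The identity also holds where [f x] is 0, both sides
   being 0 there. *)
have -> : (fun x => (f x)^-1) = (fun x => f x * (powR (f x ^+ 2) (-1))).
  apply/funext => x; have [->|fx0] := eqVneq (f x) 0; first by rewrite invr0 mul0r.
  by rewrite powRN powRr1 ?sqr_ge0// expr2 invfM mulVKf.
apply: measurable_funM => //.
apply: (measurableT_comp (measurable_powR (R := R) (-1))).
exact: measurable_funX.
Qed.

(** [invmx] returns its argument on singular matrices, so the function is split along the measurable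
    condition that the determinant vanishes, with the adjugate formula on the complement. *)
Lemma measurable_invmx n (f : S -> 'M[R]_n) :
  measurable_fun setT f -> measurable_fun setT (fun x => invmx (f x)).
Proof.
move=> mf; apply/measurable_fun_mxP => i j; rewrite /invmx.
have -> : (fun x => (if f x \in unitmx then (\det (f x))^-1 *: \adj (f x) else f x) i j) =
  (fun x => if \det (f x) == 0 then f x i j else (\det (f x))^-1 * \adj (f x) i j).
  apply/funext => x; rewrite unitmxE unitfE; case: ifPn; case: eqVneq => //.
  by rewrite mxE.
have mdet := measurable_det mf.
apply: measurable_fun_ifT.
- by apply: measurable_fun_eqr => //; exact: measurable_cst.
- by move/measurable_fun_mxP : mf; exact.
- apply: measurable_funM; first exact: measurable_invr.
  by move/measurable_adjmx/measurable_fun_mxP : mf; exact.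
Qed.

End measurable_matrix_operations.

Section haar.
Context {R : realType} (m n : nat).

Lemma lebesgue_measure_translate (a : R) (A : set R) : measurable A ->
  lebesgue_measure ((fun x => x + a) @^-1` A) = lebesgue_measure A.
Proof.
move=> mA.
have mt : measurable_fun setT ((fun x => x + a) : _ -> measurableTypeR R).
  by apply: measurable_funD => //; exact: measurable_cst.
pose nu := pushforward_measure
  (@lebesgue_measure R) mt.
apply/esym/(@lebesgue_measure_unique _ nu) => //= _ [[x y]] _ <-.
rewrite /pushforward (_ : _ @^-1` _ = `]x - a, y - a]%classic); last first.
  by apply/seteqP; split => z /=; rewrite !in_itv/= ltrBlDr lerBrDr.
by rewrite !lebesgue_measure_itv/= !lte_fin ltrD2r -!EFinB opprB addrA subrK.
Qed.

Lemma lebesgue_mx_translate (a : 'M[R]_(m, n)) E : measurable E ->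
  lebesgue_mx ((fun M => M + a) @^-1` E) = lebesgue_mx E.
Proof.
have mt : measurable_fun setT (fun M : 'M[R]_(m, n) => M + a).
  by apply: measurable_addmx; [exact: measurable_id|exact: measurable_cst].
pose nu := pushforward_measure
  (@lebesgue_mx R m n) mt.
move=> mE; apply/esym/(@lebesgue_mx_unique _ _ _ nu) => // A mA.
rewrite /= /pushforward.
rewrite (_ : _ @^-1` _ = mx_box (fun i j => (fun x => x + a i j) @^-1` A i j)).
  rewrite lebesgue_mx_box.
    by apply: eq_bigr => i _; apply: eq_bigr => j _; exact: lebesgue_measure_translate.
  move=> i j; rewrite -[X in measurable X]setTI.
  by apply: measurable_funD => //; exact: measurable_cst.
by apply/seteqP; split=> M /= h i j; have := h i j; rewrite mxE.
Qed.

Section uniqueness.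
Variable mu : {sigma_finite_measure set 'M[R]_(m, n) -> \bar R}.
Hypothesis mu_translate : forall (a : 'M[R]_(m, n)) (E : set 'M[R]_(m, n)), measurable E ->
  mu ((fun M => M + a) @^-1` E) = mu E.

Lemma integral_translate (a : 'M[R]_(m, n)) (f : 'M[R]_(m, n) -> \bar R) :
  measurable_fun setT f -> (forall x, 0 <= f x)%E ->
  (\int[mu]_M f (M + a)%R = \int[mu]_M f M)%E.
Proof.
move=> mf f0.
have mt : measurable_fun setT (fun M : 'M[R]_(m, n) => M + a).
  by apply: measurable_addmx; [exact: measurable_id|exact: measurable_cst].
have := ge0_integral_pushforward mt mu measurableT mf (fun x _ => f0 x).
rewrite preimage_setT => <-; apply: eq_measure_integral => E mE _.
exact: mu_translate.
Qed.

End uniqueness.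

Definition unit_cube : set 'M[R]_(m, n) := mx_box (fun _ _ => [set` `[0, 1]%R]).

Lemma measurable_unit_cube : measurable unit_cube.
Proof. exact: measurable_mx_box. Qed.

Lemma lebesgue_mx_unit_cube : lebesgue_mx unit_cube = 1%E.
Proof.
rewrite lebesgue_mx_box// big1// => i _; rewrite big1// => j _.
by rewrite lebesgue_measure_itv/= lte_fin ltr01 oppr0 adde0.
Qed.

(** Both sides evaluate the integral of 1_E(x) 1_F(x + y) over x under [mu] and y under Lebesgue
    measure. Integrating in y first gives the left side. Shifting x by - y, which [mu] permits, and
    then integrating in y gives the right side. *)
Lemma translation_invariant_symmetry (mu : {sigma_finite_measure set 'M[R]_(m, n) -> \bar R})
    (E F : set 'M[R]_(m, n)) :
  (forall (a : 'M[R]_(m, n)) (E : set 'M[R]_(m, n)), measurable E -> mu ((fun M => M + a) @^-1` E) = mu E) ->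
  measurable E -> measurable F ->
  (mu E * lebesgue_mx F = mu F * lebesgue_mx ((fun M => (- M)%R) @^-1` E))%E.
Proof.
move=> hmu mE mF.
have mI (G : set 'M[R]_(m, n)) (mG : measurable G) d (S : measurableType d) (g : S -> 'M[R]_(m, n)) :
    measurable_fun setT g -> measurable_fun setT (fun x => (\1_G (g x) : R)%:E).
  move=> mg; apply/measurable_EFinP; apply: (measurableT_comp _ mg).
  exact: measurable_indic.
have I0 (G : set 'M[R]_(m, n)) x : (0 <= (\1_G x : R)%:E)%E by rewrite lee_fin.
have m1 := measurable_fst (T1 := 'M[R]_(m, n)) (T2 := 'M[R]_(m, n)).
have m2 := measurable_snd (T1 := 'M[R]_(m, n)) (T2 := 'M[R]_(m, n)).
have mm := @measurable_id _ 'M[R]_(m, n) setT.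
have mc a := @measurable_cst _ _ 'M[R]_(m, n) 'M[R]_(m, n) setT a.
have intI (nu : {measure set 'M[R]_(m, n) -> \bar R}) G (mG : measurable G) :
    (\int[nu]_x (\1_G x : R)%:E = nu G)%E.
  by rewrite integral_indic// setIT.
transitivity (\int[mu]_x \int[lebesgue_mx]_y ((\1_E x : R)%:E * (\1_F (x + y)%R : R)%:E))%E.
  rewrite -(intI mu)// -ge0_integralZr//; last exact: mI.
  apply: eq_integral => x _; rewrite ge0_integralZl//; last first.
    by apply: mI => //; exact: measurable_addmx.
  congr (_ * _)%E; rewrite -(intI lebesgue_mx)//.
  rewrite -(integral_translate lebesgue_mx_translate x)//; last exact: mI.
  by apply: eq_integral => y _; rewrite addrC.
rewrite (fubini_tonelli (fun p : 'M[R]_(m, n) * 'M[R]_(m, n) =>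
    (\1_E p.1 : R)%:E * (\1_F (p.1 + p.2)%R : R)%:E)%E)/=; last 2 first.
- apply: emeasurable_funM; apply: mI => //.
  exact: measurable_addmx.
- by move=> x; exact: mule_ge0.
transitivity (\int[lebesgue_mx]_y \int[mu]_x ((\1_E (x - y)%R : R)%:E * (\1_F x : R)%:E))%E.
  apply: eq_integral => y _.
  rewrite -[RHS](integral_translate hmu y)//.
  - by apply: eq_integral => x _; rewrite addrK.
  - apply: emeasurable_funM; apply: mI => //.
    exact: measurable_addmx.
rewrite -(fubini_tonelli (fun p : 'M[R]_(m, n) * 'M[R]_(m, n) =>
    (\1_E (p.1 - p.2)%R : R)%:E * (\1_F p.1 : R)%:E)%E)/=; last 2 first.
- apply: emeasurable_funM; apply: mI => //.
  by apply: measurable_addmx => //; exact: measurable_oppmx.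
- by move=> x; exact: mule_ge0.
rewrite -(intI mu)// -ge0_integralZr//; last exact: mI.
apply: eq_integral => x _; rewrite ge0_integralZr//; last first.
  by apply: mI => //; apply: measurable_addmx => //; exact: measurable_oppmx.
rewrite muleC; congr (_ * _)%E.
have mN : measurable ((fun M : 'M[R]_(m, n) => - M) @^-1` E).
  by rewrite -[X in measurable X]setTI; exact: measurable_oppmx.
(* Shifting y by x turns 1_E(x - y) into 1_E(- y). *)
rewrite -(intI lebesgue_mx)// -(integral_translate lebesgue_mx_translate x)//.
- by apply: eq_integral => y _; rewrite opprD addrCA subrr addr0.
- by apply: mI => //; apply: measurable_addmx => //; exact: measurable_oppmx.
Qed.

(** Symmetry against the unit cube, whose Lebesgue measure is 1, gives [mu E] as [mu unit_cube]
    times the Lebesgue measure of - E. The same symmetry for Lebesgue measure itself shows that - E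
    and E have equal measure. *)
Lemma haar_unique (mu : {sigma_finite_measure set 'M[R]_(m, n) -> \bar R}) :
  (forall (a : 'M[R]_(m, n)) (E : set 'M[R]_(m, n)), measurable E -> mu ((fun M => M + a) @^-1` E) = mu E) ->
  forall E : set 'M[R]_(m, n), measurable E -> mu E = (mu unit_cube * lebesgue_mx E)%E.
Proof.
move=> hmu E mE; have mC := measurable_unit_cube.
have := translation_invariant_symmetry lebesgue_mx_translate mE mC.
have := translation_invariant_symmetry hmu mE mC.
by rewrite /= lebesgue_mx_unit_cube !mule1 mul1e => -> ->.
Qed.

End haar.
Arguments unit_cube {R m n}.
Arguments lebesgue_mx_unit_cube {R m n}.
Arguments measurable_unit_cube {R m n}.

(** * Linear change of variables *)

(** Block elimination with pivot [a]: the outer factors are unipotent, the inner ones block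
    diagonal, and the Schur complement of [a] appears in the third. *)
Lemma mul_pivot_blocks (F : fieldType) n (g : 'M[F]_(1 + n)) (a : F) :
  a != 0 -> ulsubmx g = a%:M ->
  g = block_mx 1%:M 0 (a^-1 *: dlsubmx g) 1%:M
    *m block_mx a%:M 0 0 1%:M
    *m block_mx 1%:M 0 0 (drsubmx g - a^-1 *: (dlsubmx g *m ursubmx g))
    *m block_mx 1%:M (a^-1 *: ursubmx g) 0 1%:M.
Proof.
move=> a0 ga.
rewrite !mulmx_block !(mulmx0, mul0mx, mulmx1, mul1mx, addr0, add0r).
rewrite -!scalemxAl -!scalemxAr mul_scalar_mx mul_mx_scalar -!scalemxAl !scalerA mulVf// mulr1 !scale1r.
by rewrite addrC subrK -ga submxK.
Qed.

(** A positive character is trivial on transpositions, which are involutions, and on unipotent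
    blocks. Block elimination then leaves a diagonal entry and a smaller matrix, handled by
    induction. The condition [f (- 1) = 1] absorbs the sign of a row exchange. *)
Lemma GL_character (F : realFieldType) (f : F -> F) m (c : 'M[F]_m -> F) :
  {morph f : x y / x * y} -> f 1 = 1 -> f (- 1) = 1 ->
  (forall g h, g \in unitmx -> h \in unitmx -> c (g *m h) = c g * c h) ->
  (forall g, g \in unitmx -> 0 < c g) ->
  (forall d : 'rV_m, (forall i, d 0 i != 0) -> c (diag_mx d) = f (\det (diag_mx d))) ->
  forall g, g \in unitmx -> c g = f (\det g).
Proof.
move=> fM f1 fN1; elim: m c => [|m IH] c cM c0 cd g ug.
  by rewrite [g](_ : _ = diag_mx 0) ?cd ?[LHS]flatmx0 ?[RHS]flatmx0// => -[].
have c1 : c 1%:M = 1.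
  rewrite -diag_const_mx cd; last by move=> i; rewrite mxE oner_eq0.
  by rewrite diag_const_mx det1.
have idem x : 0 < x -> x * x = x -> x = 1.
  by move=> x0 xx; apply: (mulfI (lt0r_neq0 x0)); rewrite mulr1.
have ublk (A : 'M[F]_1) (B : 'M[F]_m) v : A \in unitmx -> B \in unitmx ->
    block_mx A 0 v B \in @unitmx F (1 + m).
  by rewrite !unitmxE det_lblock => uA uB; rewrite unitrM uA.
have ublk' (A : 'M[F]_1) (B : 'M[F]_m) v : A \in unitmx -> B \in unitmx ->
    block_mx A v 0 B \in @unitmx F (1 + m).
  by rewrite !unitmxE det_ublock => uA uB; rewrite unitrM uA.
have uS n (a : F) : a != 0 -> a%:M \in @unitmx F n.
  by move=> a0; rewrite unitmxE det_scalar unitrX// unitfE.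
have u1 n := uS n 1 (oner_neq0 F).
have u2 := uS m 2 (lt0r_neq0 (ltr0n F 2)).
(* A unipotent block is conjugate to its square, so [c] sends it to [1]. *)
have cL v : c (block_mx 1%:M 0 v 1%:M : 'M[F]_(1 + m)) = 1.
  set U : 'M[F]_(1 + m) := block_mx _ _ _ _.
  pose D : 'M[F]_(1 + m) := block_mx 1%:M 0 0 2%:M.
  have uU : U \in unitmx by exact: ublk.
  have uD : D \in unitmx by exact: ublk.
  apply: idem; first exact: c0.
  have DU : D *m U = U *m U *m D.
    rewrite /U /D !mulmx_block !(mulmx0, mul0mx, mulmx1, mul1mx, addr0, add0r).
    by rewrite mul_scalar_mx scaler_nat mulr2n.
  apply: (mulfI (lt0r_neq0 (c0 _ uD))).
  by rewrite [LHS]mulrC -!cM ?unitmx_mul ?uU// DU.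
have cU v : c (block_mx 1%:M v 0 1%:M : 'M[F]_(1 + m)) = 1.
  set U : 'M[F]_(1 + m) := block_mx _ _ _ _.
  pose D : 'M[F]_(1 + m) := block_mx 1%:M 0 0 2%:M.
  have uU : U \in unitmx by exact: ublk'.
  have uD : D \in unitmx by exact: ublk.
  apply: idem; first exact: c0.
  have DU : U *m D = D *m (U *m U).
    rewrite /U /D !mulmx_block !(mulmx0, mul0mx, mulmx1, mul1mx, addr0, add0r).
    by rewrite mul_mx_scalar scaler_nat mulr2n.
  apply: (mulfI (lt0r_neq0 (c0 _ uD))).
  by rewrite [RHS]mulrC -!cM ?unitmx_mul ?uU// DU.
have ctperm i j : c (tperm_mx i j) = 1.
  have ut : tperm_mx i j \in @unitmx F m.+1 by exact: unitmx_perm.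
  have : c (tperm_mx i j) ^+ 2 == 1.
    by rewrite expr2 -cM// -perm_mxM tperm2 perm_mx1 c1.
  by rewrite sqrp_eq1 ?ltW ?c0// => /eqP.
have key (h : 'M[F]_(1 + m)) : h \in unitmx -> h 0 0 != 0 -> c h = f (\det h).
  move=> uh h0.
  have hul : ulsubmx h = (h 0 0)%:M.
    by apply/matrixP => i j; rewrite !ord1 !mxE eqxx/=; congr (h _ _); exact: val_inj.
  have hE := mul_pivot_blocks h0 hul.
  set S := (X in block_mx 1%:M 0 0 X) in hE.
  have uS1 : S \in unitmx.
    move: uh; rewrite {1}hE !unitmx_mul => /andP[/andP[_ +] _].
    by rewrite !unitmxE det_lblock det1 mul1r.
  have dh : \det h = h 0 0 * \det S.
    rewrite {1}hE !det_mulmx !det_lblock det_ublock !det1 det_scalar expr1.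
    by rewrite !(mul1r, mulr1).
  (* The restriction of [c] to the lower right block is a character of the smaller group, to which
     the induction hypothesis applies. *)
  pose c' (B : 'M[F]_m) := c (block_mx 1%:M 0 0 B : 'M[F]_(1 + m)).
  have -> : c h = c (block_mx (h 0 0)%:M 0 0 1%:M : 'M[F]_(1 + m)) * c' S.
    have uL v : block_mx 1%:M 0 v 1%:M \in @unitmx F (1 + m) by exact: ublk.
    have uU v : block_mx 1%:M v 0 1%:M \in @unitmx F (1 + m) by exact: ublk'.
    have ua : block_mx (h 0 0)%:M 0 0 1%:M \in @unitmx F (1 + m) by apply: ublk; rewrite ?uS.
    have uc : block_mx 1%:M 0 0 S \in @unitmx F (1 + m) by exact: ublk.
    by rewrite {1}hE !cM ?unitmx_mul ?uL ?uU ?ua ?uc// cL cU mul1r mulr1.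
  rewrite dh fM; congr (_ * _).
    have E : block_mx (h 0 0)%:M 0 0 1%:M =
        diag_mx (row_mx (const_mx (h 0 0)) (const_mx 1)) :> 'M[F]_(1 + m).
      by rewrite diag_mx_row !diag_const_mx.
    have dE : \det (block_mx (h 0 0)%:M 0 0 1%:M : 'M[F]_(1 + m)) = h 0 0.
      by rewrite det_ublock det_scalar1 det1 mulr1.
    rewrite E cd -?E; first exact: (congr1 f dE).
    by move=> i; rewrite mxE; case: splitP => j _; rewrite mxE// oner_eq0.
  apply: (IH c') => //.
  - move=> A B uA uB.
    have E : block_mx 1%:M 0 0 (A *m B) =
        block_mx 1%:M 0 0 A *m block_mx 1%:M 0 0 B :> 'M[F]_(1 + m).
      by rewrite mulmx_block !(mulmx0, mul0mx, mulmx1, mul1mx, addr0, add0r).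
    by rewrite /c' E cM ?ublk ?u1.
  - by move=> A uA; apply: c0; rewrite ublk ?u1.
  - move=> d d0; rewrite /c'.
    have E : block_mx 1%:M 0 0 (diag_mx d) = diag_mx (row_mx (const_mx 1) d) :> 'M[F]_(1 + m).
      by rewrite diag_mx_row !diag_const_mx.
    have dE : \det (block_mx 1%:M 0 0 (diag_mx d) : 'M[F]_(1 + m)) = \det (diag_mx d).
      by rewrite det_ublock det1 mul1r.
    rewrite E cd -?E; first exact: (congr1 f dE).
    by move=> i; rewrite mxE; case: splitP => j _; rewrite ?mxE ?oner_eq0.
(* An invertible matrix has a nonzero entry in its first column; a row exchange moves it to the
   pivot position, where [key] applies. *)
have [i gi0] : exists i, g i 0 != 0.
  apply/existsP; rewrite -negb_forall; apply/negP => /forallP h.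
  move: ug; rewrite unitmxE (expand_det_col _ 0) big1 ?unitr0// => i _.
  by have /eqP -> := h i; rewrite mul0r.
have ut : tperm_mx 0 i \in @unitmx F m.+1 by exact: unitmx_perm.
have := key (tperm_mx 0 i *m g); rewrite cM// ctperm mul1r det_mulmx fM det_perm => ->.
- by case: (odd_perm _); rewrite ?expr1 ?expr0 ?f1 ?fN1 mul1r.
- by rewrite unitmx_mul ut.
- by rewrite -[tperm_mx _ _]/(perm_mx _) -row_permE mxE tpermL.
Qed.

Section linear_change_of_variables.
Context {R : realType}.

Lemma lebesgue_measure_scale_unit_itv (a : R) : a != 0 ->
  lebesgue_measure ((fun x => a * x) @^-1` [set` `[0, 1]%R]) = (`|a|^-1)%:E.
Proof.
move=> a0; case: (ltgtP a 0) a0 => // a0 _.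
- rewrite (_ : _ @^-1` _ = [set` `[a^-1, 0]%R]).
    by rewrite lebesgue_measure_itv/= lte_fin invr_lt0 a0 -EFinB sub0r ltr0_norm// invrN.
  apply/seteqP; split=> x /=; rewrite !in_itv/=.
    move=> /andP[h1 h2]; rewrite -(ler_nM2l a0) divff ?ltr0_neq0// h2/=.
    by rewrite -(nmulr_rge0 _ a0).
  by move=> /andP[h1 h2]; rewrite (nmulr_rge0 _ a0) h2 -(divff (ltr0_neq0 a0)) ler_nM2l.
- rewrite (_ : _ @^-1` _ = [set` `[0, a^-1]%R]).
    by rewrite lebesgue_measure_itv/= lte_fin invr_gt0 a0 -EFinB subr0 gtr0_norm.
  apply/seteqP; split=> x /=; rewrite !in_itv/= (pmulr_rge0 _ a0) => /andP[-> h]/=.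
    by rewrite -(ler_pM2l a0) divff ?gt_eqF.
  by rewrite -(divff (lt0r_neq0 a0)) ler_pM2l.
Qed.

Section left_multiplication.
Variables m n : nat.
Implicit Types g h : 'M[R]_m.

Let measurable_mull g : measurable_fun setT (fun M : 'M[R]_(m, n) => g *m M).
Proof. by apply: measurable_mulmx; [exact: measurable_cst|exact: measurable_id]. Qed.

(** Once preimages under multiplication by [g] are known to scale Lebesgue measure by a constant,
    the unit cube, of measure 1, exhibits that constant. *)
Let c g := lebesgue_mx ((fun M : 'M[R]_(m, n) => g *m M) @^-1` unit_cube).

(** The pushforward of Lebesgue measure by [g] is again translation invariant, because a shift by
    [a] after the multiplication is a shift by [invmx g *m a] before it. Uniqueness of Haar measure
    applies. *)
Let mull_measure g (E : set 'M[R]_(m, n)) : g \in unitmx -> measurable E ->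
  lebesgue_mx ((fun M => g *m M) @^-1` E) = (c g * lebesgue_mx E)%E.
Proof.
move=> ug mE.
have [nu nuE] := pushforward_sigma_finite_measure
  (sigma_finiteT (@lebesgue_mx R m n)) (measurable_mull g)
  (measurable_mull (invmx g)) (mulKmx ug).
have nuF F : nu F = lebesgue_mx ((fun M => g *m M) @^-1` F).
  by rewrite -[LHS]/(SigmaFiniteMeasure.sort nu F) nuE.
rewrite -nuF (haar_unique (mu := nu)) ?nuF// => a F mF.
rewrite !nuF -[RHS](lebesgue_mx_translate (invmx g *m a)).
  congr (lebesgue_mx _); apply/seteqP; split => M /=; rewrite mulmxDr mulKVmx//.
rewrite -[X in measurable X]setTI.
exact: measurable_mull.
Qed.

Let cM g h : g \in unitmx -> h \in unitmx -> c (g *m h) = (c g * c h)%E.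
Proof.
move=> ug uh; rewrite {1}/c.
have -> : (fun M : 'M[R]_(m, n) => g *m h *m M) @^-1` unit_cube =
    (fun M => h *m M) @^-1` ((fun M => g *m M) @^-1` unit_cube).
  by apply/seteqP; split=> M /=; rewrite mulmxA.
rewrite mull_measure//; first by rewrite muleC.
by rewrite -[X in measurable X]setTI; apply: measurable_mull => //; exact: measurable_unit_cube.
Qed.

Let c1 : c 1%:M = 1%E.
Proof.
by rewrite /c -[RHS](@lebesgue_mx_unit_cube R m n); congr lebesgue_mx; apply/seteqP;
  split=> M /=; rewrite mul1mx.
Qed.

(** The factors of [g] and of its inverse multiply to 1, which rules out both 0 and infinity. *)
Let c_fin_gt0 g : g \in unitmx -> (c g \is a fin_num) && (0 < c g)%E.
Proof.
move=> ug; have uV : invmx g \in unitmx by rewrite unitmx_inv.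
have h := cM ug uV; rewrite mulmxV// c1 in h.
have hg : (0 <= c g)%E by exact: measure_ge0.
have hV : (0 <= c (invmx g))%E by exact: measure_ge0.
have c0 : (0 < c g)%E.
  by rewrite lt_def hg andbT; apply/eqP => g0; move: h; rewrite g0 mul0e => -[] /eqP;
    rewrite oner_eq0.
rewrite c0 andbT ge0_fin_numE// ltey; apply/eqP => gy; move: h; rewrite gy.
have [->|V0] := eqVneq (c (invmx g)) 0%E.
  by rewrite mule0 => -[] /eqP; rewrite oner_eq0.
by rewrite gt0_mulye// lt_def V0.
Qed.

(** By [GL_character] only diagonal matrices need a computation. There the preimage of the unit cube
    is a box, and the i-th diagonal entry contributes one side of length 1 / |d_i| in each of the
    [n] columns. *)
Let cE g : g \in unitmx -> c g = ((`|\det g| ^- n)%:E)%E.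
Proof.
move=> ug.
have fin h (uh : h \in unitmx) : c h = (fine (c h))%:E.
  by have /andP[? _] := c_fin_gt0 uh; rewrite fineK.
rewrite fin//; congr EFin.
apply: (@GL_character R (fun x => `|x| ^- n) m (fun g => fine (c g))) => //.
- by move=> x y; rewrite normrM exprMn invfM.
- by rewrite normr1 expr1n invr1.
- by rewrite normrN1 expr1n invr1.
- by move=> x y ux uy; rewrite cM// (fin x)// (fin y).
- by move=> h uh; have /andP[_] := c_fin_gt0 uh; rewrite {1}fin// lte_fin.
- move=> d d0.
  rewrite /c (_ : _ @^-1` _ = mx_box (fun i j => (fun x => d 0 i * x) @^-1` [set` `[0, 1]%R])).
    rewrite lebesgue_mx_box; last first.
      move=> i j; rewrite -[X in measurable X]setTI.
      by apply: measurable_funM => //; exact: measurable_cst.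
    under eq_bigr do under eq_bigr do rewrite lebesgue_measure_scale_unit_itv//.
rewrite (eq_bigr (fun i => (`|d 0 i|^-1 ^+ n)%:E)); last first.
      by move=> i _; rewrite prodEFin prodr_const card_ord.
    by rewrite prodEFin/= det_diag normr_prod -exprVn -prodfV prodrXl.
  apply/seteqP; split=> M /= h i j; have := h i j; rewrite mul_diag_mx mxE//.
Qed.

Lemma lebesgue_mx_mulmxl g (E : set 'M[R]_(m, n)) : g \in unitmx -> measurable E ->
  (lebesgue_mx ((fun M => g *m M) @^-1` E) = (`|\det g| ^- n)%:E * lebesgue_mx E)%E.
Proof. by move=> ug mE; rewrite mull_measure// cE. Qed.

Lemma integral_mulmxl g (f : 'M[R]_(m, n) -> \bar R) : g \in unitmx ->
  measurable_fun setT f -> (forall M, 0 <= f M)%E ->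
  (\int[lebesgue_mx]_M f M = (`|\det g| ^+ n)%:E * \int[lebesgue_mx]_M f (g *m M))%E.
Proof.
move=> ug mf f0.
have dg : 0 < `|\det g| ^+ n.
  by rewrite exprn_gt0// normr_gt0; move: ug; rewrite unitmxE unitfE.
have k0 : 0 <= `|\det g| ^+ n by exact: ltW.
(* Rescaling the pushforward by |det g|^n recovers Lebesgue measure. *)
pose mu := mscale_measure
  (NngNum k0) (pushforward_measure
  (@lebesgue_mx R m n) (measurable_mull g)).
rewrite (eq_measure_integral mu); last first.
  move=> A mA _; rewrite /= /mscale/= /pushforward lebesgue_mx_mulmxl//.
  by rewrite muleA -EFinM divff ?mul1e// gt_eqF.
rewrite ge0_integral_mscale//= ge0_integral_pushforward//.
Qed.

End left_multiplication.

Lemma integral_trmx m n (f : 'M[R]_(m, n) -> \bar R) :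
  measurable_fun setT f -> (forall M, 0 <= f M)%E ->
  (\int[lebesgue_mx]_M f M = \int[lebesgue_mx]_M f M^T)%E.
Proof.
move=> mf f0.
have mt : measurable_fun setT (fun M : 'M[R]_(n, m) => M^T).
  by apply: measurable_trmx; exact: measurable_id.
pose nu := pushforward_measure
  (@lebesgue_mx R n m) mt.
rewrite (eq_measure_integral nu); first by rewrite ge0_integral_pushforward.
move=> E mE _; apply: (lebesgue_mx_unique (mu := nu)) => // A mA.
rewrite /= /pushforward (_ : _ @^-1` _ = mx_box (fun i j => A j i)).
  by rewrite lebesgue_mx_box// exchange_big.
by apply/seteqP; split=> M /= h i j; have := h j i; rewrite mxE.
Qed.

Lemma integral_mulmxr m n (g : 'M[R]_n) (f : 'M[R]_(m, n) -> \bar R) : g \in unitmx ->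
  measurable_fun setT f -> (forall M, 0 <= f M)%E ->
  (\int[lebesgue_mx]_M f M = (`|\det g| ^+ m)%:E * \int[lebesgue_mx]_M f (M *m g))%E.
Proof.
move=> ug mf f0; have mid p q := @measurable_id _ 'M[R]_(p, q) setT.
have mt p q : measurable_fun setT (@trmx R p q).
  by apply: measurable_trmx; exact: measurable_id.
rewrite integral_trmx// (@integral_mulmxl _ _ g^T (fun M => f M^T)) ?unitmx_tr//; last first.
  exact: (measurableT_comp mf (mt _ _)).
rewrite det_tr; congr (_ * _)%E.
rewrite [RHS]integral_trmx//; last first.
  by apply: (measurableT_comp mf); apply: measurable_mulmx => //; exact: measurable_cst.
by apply: eq_integral => M _; rewrite trmx_mul trmxK.
Qed.

End linear_change_of_variables.

(** * Gaussian matrices and moments of the determinant *)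

Section frobenius.
Context {R : realType}.

Definition frobenius m n (M : 'M[R]_(m, n)) : R := \tr (M *m M^T).

Lemma frobeniusE m n (M : 'M[R]_(m, n)) : frobenius M = \sum_i \sum_j M i j ^+ 2.
Proof.
by apply: eq_bigr => i _; rewrite mxE; apply: eq_bigr => j _; rewrite mxE expr2.
Qed.

Lemma frobenius_ge0 m n (M : 'M[R]_(m, n)) : 0 <= frobenius M.
Proof. by rewrite frobeniusE; do 2 (apply: sumr_ge0 => ? _); exact: sqr_ge0. Qed.

Lemma frobenius_eq0 m n (M : 'M[R]_(m, n)) : (frobenius M == 0) = (M == 0).
Proof.
apply/eqP/eqP => [|->]; last by rewrite /frobenius mul0mx mxtrace0.
rewrite frobeniusE => /psumr_eq0P h; apply/matrixP => i j; rewrite mxE.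
have /psumr_eq0P h2 : \sum_j M i j ^+ 2 = 0.
  by apply: h => // k _; apply: sumr_ge0 => ? _; exact: sqr_ge0.
by apply/eqP; rewrite -sqrf_eq0 h2// => k _; exact: sqr_ge0.
Qed.

Lemma measurable_frobenius m n : measurable_fun setT (@frobenius m n).
Proof.
apply: measurable_mxtrace; apply: measurable_mulmx; first exact: measurable_id.
by apply: measurable_trmx; exact: measurable_id.
Qed.

Lemma frobenius_scale m n (a : R) (M : 'M[R]_(m, n)) :
  frobenius (a *: M) = a ^+ 2 * frobenius M.
Proof.
by rewrite /frobenius linearZ/= -scalemxAl -scalemxAr scalerA mxtraceZ.
Qed.

Lemma frobenius_mulmxl m n (O : 'M[R]_m) (M : 'M[R]_(m, n)) : O^T *m O = 1%:M ->
  frobenius (O *m M) = frobenius M.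
Proof.
move=> OO; rewrite /frobenius trmx_mul mulmxA mxtrace_mulC !mulmxA OO mul1mx.
by [].
Qed.

Lemma frobenius_col_mx m1 m2 n (A : 'M[R]_(m1, n)) (B : 'M[R]_(m2, n)) :
  frobenius (col_mx A B) = frobenius A + frobenius B.
Proof. by rewrite /frobenius tr_col_mx mul_col_row mxtrace_block. Qed.

(** The matrix is the reflection in the hyperplane orthogonal to v = a - w, with w the target
    vector. Since |w| = |a|, twice the inner product of v and a equals that of v with itself, so a
    goes to a - v = w. For a = w this hyperplane is undefined and the identity serves. *)
Lemma householder n (a : 'cV[R]_(1 + n)) : exists O : 'M[R]_(1 + n),
  O^T *m O = 1%:M /\ O *m a = col_mx (Num.sqrt (frobenius a))%:M 0.
Proof.
set w := col_mx _ _.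
pose dot (u v : 'cV[R]_(1 + n)) := \tr (u^T *m v).
have dotE u v : u^T *m v = (dot u v)%:M.
  by rewrite /dot [u^T *m v]mx11_scalar mxtrace_scalar mulr1n.
have dotC u v : dot u v = dot v u by rewrite /dot -mxtrace_tr trmx_mul trmxK.
have dotBl u v x : dot (u - v) x = dot u x - dot v x.
  by rewrite /dot linearB/= mulmxBl raddfB.
have dotBr u v x : dot x (u - v) = dot x u - dot x v by rewrite dotC dotBl !(dotC x).
have dotF u : dot u u = frobenius u by rewrite /dot /frobenius mxtrace_mulC.
have ww : dot w w = dot a a.
  rewrite !dotF frobenius_col_mx {1 3}/frobenius mul0mx mxtrace0 addr0.
  rewrite tr_scalar_mx -scalar_mxM mxtrace_scalar mulr1n -expr2 sqr_sqrtr//.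
  exact: frobenius_ge0.
have [aw|aw] := eqVneq a w.
  by exists 1%:M; rewrite trmx1 !mul1mx.
set v := a - w.
have s0 : dot v v != 0 by rewrite dotF frobenius_eq0 subr_eq0.
have va : 2 * dot v a = dot v v.
  by rewrite /v !(dotBl, dotBr) ww (dotC a w); ring.
pose O : 'M[R]_(1 + n) := 1%:M - (2 / dot v v) *: (v *m v^T).
have OT : O^T = O.
  by rewrite /O linearB/= linearZ/= trmx_mul trmxK trmx1.
exists O; split.
  rewrite OT /O mulmxBl mul1mx mulmxBr mulmx1 -scalemxAl -!scalemxAr scalerA.
  rewrite mulmxA -(mulmxA v) dotE mul_mx_scalar -scalemxAl scalerA.
  rewrite (_ : 2 / dot v v * _ * _ = 2 / dot v v + 2 / dot v v); last by field.
  by rewrite scalerDl opprB addrK subrK.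
rewrite /O mulmxBl mul1mx -scalemxAl -mulmxA dotE mul_mx_scalar scalerA.
rewrite (_ : 2 / dot v v * _ = 1) ?scale1r; first by rewrite /v opprB addrC subrK.
have va0 : dot v a != 0.
  by apply: contra s0; rewrite -va mulf_eq0 => ->; rewrite orbT.
by rewrite -va; field.
Qed.

End frobenius.

Section gauss.
Context {R : realType}.

Definition gauss {m n} (M : 'M[R]_(m, n)) : R :=
  \prod_(i < m) \prod_(j < n) normal_pdf 0 1 (M i j).

Lemma gaussE m n (M : 'M[R]_(m, n)) :
  gauss M = (Num.sqrt (2 * pi)) ^- (m * n) * expR (- frobenius M / 2).
Proof.
rewrite /gauss; under eq_bigr do under eq_bigr do rewrite normal_pdf01.
under eq_bigr do rewrite big_split/= prodr_const card_ord -expR_sum.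
rewrite big_split/= prodr_const card_ord -expR_sum -exprM exprVn mulnC; congr (_ * expR _).
rewrite frobeniusE -sumrN mulr_suml; apply: eq_bigr => i _.
by rewrite -sumrN mulr_suml.
Qed.

Lemma gauss_gt0 m n (M : 'M[R]_(m, n)) : 0 < gauss M.
Proof.
rewrite gaussE mulr_gt0 ?expR_gt0// invr_gt0 exprn_gt0// sqrtr_gt0 mulr_gt0//.
exact: pi_gt0.
Qed.

Lemma gauss_ge0 m n (M : 'M[R]_(m, n)) : 0 <= gauss M.
Proof. exact/ltW/gauss_gt0. Qed.

Lemma measurable_gauss m n : measurable_fun setT (@gauss m n).
Proof.
have -> : @gauss m n = (fun M => (Num.sqrt (2 * pi)) ^- (m * n) * expR (- frobenius M / 2)).
  by apply/funext => M; exact: gaussE.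
apply: measurable_funM; first exact: measurable_cst.
have mq : measurable_fun setT (fun M : 'M[R]_(m, n) => - frobenius M / 2).
  apply: measurable_funM; last exact: measurable_cst.
  by apply: measurable_funN; exact: measurable_frobenius.
exact: (measurableT_comp (@measurable_expR R) mq).
Qed.

Lemma integral_gauss m n : (\int[@lebesgue_mx R m n]_M (gauss M)%:E = 1)%E.
Proof.
under eq_integral do rewrite /gauss -prodEFin.
under eq_integral do under eq_bigr do rewrite -prodEFin.
rewrite (integral_lebesgue_mx_prod (f := fun _ _ x => (normal_pdf 0 1 x)%:E)).
- by do 2 (rewrite big1// => ? _); exact: integral_normal_pdf.
- by move=> i j; apply/measurable_EFinP; exact: measurable_normal_pdf.
- by move=> i j x; rewrite lee_fin; exact: normal_pdf_ge0.
Qed.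

Lemma gauss_row_mx m n1 n2 (A : 'M[R]_(m, n1)) (B : 'M[R]_(m, n2)) :
  gauss (row_mx A B) = gauss A * gauss B.
Proof.
rewrite /gauss -big_split/=; apply: eq_bigr => i _.
rewrite big_split_ord/=; congr (_ * _); apply: eq_bigr => j _.
  by rewrite row_mxEl.
by rewrite row_mxEr.
Qed.

Lemma gauss_col_mx m1 m2 n (A : 'M[R]_(m1, n)) (B : 'M[R]_(m2, n)) :
  gauss (col_mx A B) = gauss A * gauss B.
Proof.
rewrite /gauss big_split_ord/=; congr (_ * _); apply: eq_bigr => i _;
  apply: eq_bigr => j _; by rewrite ?col_mxEu ?col_mxEd.
Qed.

Lemma gauss_mulmxl m n (O : 'M[R]_m) (M : 'M[R]_(m, n)) : O^T *m O = 1%:M ->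
  gauss (O *m M) = gauss M.
Proof. by move=> OO; rewrite !gaussE frobenius_mulmxl. Qed.

End gauss.

(** * Recursion for multiplicative moments of the determinant *)

Section det_moment.
Context {R : realType}.
Variable h : R -> R.
Hypotheses (mh : measurable_fun setT h) (h0 : forall x, 0 <= h x).
Hypotheses (hM : {morph h : x y / x * y}) (hN : forall x, h (- x) = h x).

Definition det_moment n := (\int[@lebesgue_mx R n n]_M (h (\det M) * gauss M)%:E)%E.
Definition norm_moment n :=
  (\int[@lebesgue_mx R n 1]_a (h (Num.sqrt (frobenius a)) * gauss a)%:E)%E.

(** Rotating the remaining columns changes neither Lebesgue measure nor the Gaussian weight, and [h]
    ignores the factor 1 or -1 in the determinant. The fixed column may thus be replaced by |a| e_1,
    which makes the matrix block triangular. *)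
Lemma det_moment_rotation n (a : 'cV[R]_(1 + n)) :
  (\int[@lebesgue_mx R (1 + n) n]_C (h (\det (row_mx a C)) * gauss C)%:E =
   (h (Num.sqrt (frobenius a)))%:E * det_moment n)%E.
Proof.
have [Q [QQ Qa]] := householder a.
have QQ' : Q *m Q^T = 1%:M by apply: mulmx1C.
have mc p q (b : 'M[R]_(p, q)) : measurable_fun [set: 'M[R]_(1 + n, n)] (fun=> b) by exact: measurable_cst.
have mid (p q : nat) := @measurable_id _ 'M[R]_(p, q) setT.
have mrow (b : 'cV[R]_(1 + n)) : measurable_fun setT (fun C : 'M[R]_(1 + n, n) => row_mx b C).
  by apply: measurable_row_mx; [exact: mc|exact: mid].
have mF (b : 'cV[R]_(1 + n)) : measurable_fun setT
    (fun C : 'M[R]_(1 + n, n) => (h (\det (row_mx b C)) * gauss C)%:E).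
  apply/measurable_EFinP/measurable_funM; last exact: measurable_gauss.
  by apply: (measurableT_comp mh); exact: measurable_det.
have F0 (b : 'cV[R]_(1 + n)) C : (0 <= (h (\det (row_mx b C)) * gauss C)%:E)%E.
  by rewrite lee_fin mulr_ge0// gauss_ge0.
have uO : Q^T \in unitmx by case/mulmx1_unit : QQ.
have dO : (\det Q^T == 1) || (\det Q^T == -1).
  by rewrite -sqrf_eq1 expr2 {2}det_tr -det_mulmx QQ det1.
have hO x : h (\det Q^T * x) = h x.
  by case/orP: dO => /eqP ->; rewrite ?mul1r// mulN1r hN.
rewrite (integral_mulmxl uO)//.
rewrite (_ : `|\det Q^T| = 1) ?expr1n ?mul1e; last first.
  by case/orP: dO => /eqP ->; rewrite ?normrN1 ?normr1.
transitivity (\int[@lebesgue_mx R (1 + n) n]_C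
   (h (\det (row_mx (Q *m a) C)) * gauss C)%:E)%E.
  apply: eq_integral => C _; rewrite gauss_mulmxl ?trmxK//.
  rewrite -[in RHS]hO -det_mulmx mul_mx_row mulmxA QQ mul1mx//.
rewrite Qa integral_col_mx//.
set k := Num.sqrt _.
have mD : measurable_fun setT (fun D : 'M[R]_n => (h (\det D) * gauss D)%:E).
  apply/measurable_EFinP/measurable_funM; last exact: measurable_gauss.
  by apply: (measurableT_comp mh); apply: measurable_det; exact: mid.
have D0 (D : 'M[R]_n) : (0 <= (h (\det D) * gauss D)%:E)%E.
  by rewrite lee_fin mulr_ge0// gauss_ge0.
have mg : measurable_fun setT (fun r : 'M[R]_(1, n) => (gauss r)%:E).
  by apply/measurable_EFinP; exact: measurable_gauss.
(* The top row [r] does not enter the determinant, so it only contributes its total Gaussian mass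
   1. *)
transitivity (\int[@lebesgue_mx R 1 n]_r
    ((h k)%:E * (gauss r)%:E * det_moment n))%E.
  apply: eq_integral => r _.
  rewrite -ge0_integralZl//; last by rewrite -EFinM lee_fin mulr_ge0// gauss_ge0.
  apply: eq_integral => D _; rewrite -block_mxEh det_ublock det_scalar1 hM gauss_col_mx.
  by rewrite mulrACA !EFinM.
rewrite ge0_integralZr//; last 3 first.
- exact: emeasurable_funM.
- by move=> r _; rewrite -EFinM lee_fin mulr_ge0// gauss_ge0.
- exact: integral_ge0.
rewrite ge0_integralZl//; last 2 first.
- by move=> r _; rewrite lee_fin gauss_ge0.
- by rewrite lee_fin.
by rewrite integral_gauss mule1.
Qed.

(** The first column is integrated last: the Gaussian weight factorises over the two blocks of
    columns, and [det_moment_rotation] evaluates the inner integral. *)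
Lemma det_moment_rec n : det_moment n.+1 = (norm_moment n.+1 * det_moment n)%E.
Proof.
have mid (p q : nat) := @measurable_id _ 'M[R]_(p, q) setT.
transitivity (\int[@lebesgue_mx R (1 + n) (1 + n)]_M (h (\det M) * gauss M)%:E)%E => //.
have mM : measurable_fun setT (fun M : 'M[R]_(1 + n) => (h (\det M) * gauss M)%:E).
  apply/measurable_EFinP/measurable_funM; last exact: measurable_gauss.
  by apply: (measurableT_comp mh); apply: measurable_det; exact: mid.
have ma : measurable_fun setT
    (fun a : 'M[R]_(1 + n, 1) => (h (Num.sqrt (frobenius a)) * gauss a)%:E).
  apply/measurable_EFinP/measurable_funM; last exact: measurable_gauss.
  apply: (measurableT_comp mh).
  under eq_fun do rewrite -powR12_sqrt ?frobenius_ge0//.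
  apply: (measurableT_comp (measurable_powR _)).
  exact: measurable_frobenius.
have M0 (M : 'M[R]_(1 + n)) : (0 <= (h (\det M) * gauss M)%:E)%E.
  by rewrite lee_fin mulr_ge0// gauss_ge0.
have a0 (a : 'M[R]_(1 + n, 1)) : (0 <= (h (Num.sqrt (frobenius a)) * gauss a)%:E)%E.
  by rewrite lee_fin mulr_ge0// gauss_ge0.
rewrite (@integral_row_mx _ (1 + n) 1 n)// /norm_moment -ge0_integralZr//; last first.
  by apply: integral_ge0 => D _; rewrite lee_fin mulr_ge0// gauss_ge0.
apply: eq_integral => a _.
rewrite EFinM muleAC -det_moment_rotation muleC -ge0_integralZl//.
- by apply: eq_integral => C _; rewrite gauss_row_mx -EFinM mulrCA.
- apply/measurable_EFinP/measurable_funM; last exact: measurable_gauss.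
  apply: (measurableT_comp mh); apply: measurable_det; apply: measurable_row_mx => //.
- by move=> C _; rewrite lee_fin mulr_ge0// gauss_ge0.
- by rewrite lee_fin gauss_ge0.
Qed.

(** The recursion ends at the empty matrix, whose determinant is 1; this leaves the factor [h 1]. *)
Lemma det_moment_prod n :
  det_moment n = ((h 1)%:E * \prod_(k < n) norm_moment k.+1)%E.
Proof.
elim: n => [|n IH].
  rewrite big_ord0 mule1 /det_moment.
  under eq_integral do rewrite det_mx00 EFinM.
  rewrite ge0_integralZl//.
  - by rewrite integral_gauss mule1.
  - by apply/measurable_EFinP; exact: measurable_gauss.
  - by move=> M _; rewrite lee_fin gauss_ge0.
  - by rewrite lee_fin.
by rewrite det_moment_rec IH big_ord_recr/= muleCA (muleC (norm_moment _)).
Qed.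

End det_moment.

(** * Gamma integrals and radial moments *)

Section gamma.
Context {R : realType}.
Local Notation mu := (@lebesgue_measure R).
Local Notation pos := ([set` `]0, +oo[%R] : set R).

(** Extended-real form of [Gamma], in which divergence stays visible: [fine] would send an infinite
    integral to 0. *)
Definition eGamma (x : R) : \bar R :=
  (\int[mu]_(t in pos) (t `^ (x - 1) * expR (- t))%:E)%E.

Lemma GammaE x : Gamma x = fine (eGamma x). Proof. by []. Qed.

Lemma integral_scale (l : R) (f : R -> \bar R) : 0 < l ->
  measurable_fun setT f -> (forall x, 0 <= f x)%E ->
  (\int[mu]_x f x = l%:E * \int[mu]_x f (l * x)%R)%E.
Proof.
move=> l0 mf f0.
have ml : measurable_fun setT ((fun x => l * x) : _ -> measurableTypeR R).
  by apply: measurable_funM => //; exact: measurable_cst.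
have k0 : 0 <= l by exact: ltW.
pose nu := mscale_measure
  (NngNum k0) (pushforward_measure
  (@lebesgue_measure R) ml).
rewrite (eq_measure_integral nu); last first.
  move=> A mA _; apply: (@lebesgue_measure_unique _ nu) => //= _ [[x y]] _ <-.
  rewrite /mscale/= /pushforward (_ : _ @^-1` _ = `]x / l, y / l]%classic); last first.
    by apply/seteqP; split => z /=; rewrite !in_itv/= ltr_pdivrMr// ler_pdivlMr// mulrC.
  rewrite !lebesgue_measure_itv/= !lte_fin ltr_pM2r ?invr_gt0//.
  by case: ifP => _; rewrite ?mule0// -!EFinB -EFinM -mulrBl mulrC divfK// gt_eqF.
by rewrite ge0_integral_mscale//= ge0_integral_pushforward.
Qed.

Lemma measurable_powR_expR (a l : R) :
  measurable_fun setT (fun t : R => (t `^ a * expR (- (l * t)))%:E).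
Proof.
apply/measurable_EFinP/measurable_funM; first exact: measurable_powR.
have ml : measurable_fun setT (fun t : R => - (l * t)).
  by apply: measurable_funN; apply: measurable_funM => //; exact: measurable_cst.
exact: (measurableT_comp (@measurable_expR R) ml).
Qed.

Lemma eGamma_scale (x l : R) : 0 < l ->
  (\int[mu]_(t in pos) (t `^ (x - 1) * expR (- (l * t)))%:E = (l `^ (- x))%:E * eGamma x)%E.
Proof.
move=> l0.
have ll : l `^ (- x) * l * l `^ (x - 1) = 1.
  rewrite -[X in _ * X * _]powRr1 ?ltW// -!powRD ?(gt_eqF l0) ?implybT//.
  by rewrite (_ : - x + 1 + (x - 1) = 0) ?powRr0//; ring.
pose G (k t : R) := (t `^ (x - 1) * expR (- (k * t)))%:E.
have G0 k t : (0 <= (G k \_ pos) t)%E.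
  by rewrite patchE; case: ifP => // _; rewrite lee_fin mulr_ge0// ?powR_ge0 ?expR_ge0.
have mG k : measurable_fun setT (G k \_ pos).
  apply/(measurable_restrictT _ _).1 => //.
  by apply: measurable_funTS; exact: measurable_powR_expR.
have -> : eGamma x = (\int[mu]_t (G 1%R \_ pos) t)%E.
  rewrite /eGamma integral_mkcond; apply: eq_integral => t _.
  by rewrite /G !patchE mul1r.
rewrite integral_mkcond (integral_scale l0 (mG 1%R))// muleA -EFinM -ge0_integralZl//.
- apply: eq_integral => t _; rewrite /G !patchE.
  rewrite !mem_setE/= !in_itv/= !andbT pmulr_rgt0//.
  case: ifPn => t0; last by rewrite mule0.
  rewrite -EFinM; congr EFin.
  by rewrite mul1r powRM ?ltW// !mulrA ll mul1r.
- apply: (measurableT_comp (mG 1%R)).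
  by apply: measurable_funM => //; exact: measurable_cst.
- by rewrite lee_fin mulr_ge0 ?powR_ge0// ltW.
Qed.

(* The Laplace-type kernel relating the moments of two different densities;
   only the fact that it depends on [b] and [r] alone matters. *)
Definition kappa (b r : R) : \bar R :=
  (\int[mu]_(u in pos) (u `^ (r - 1) * (1 + u) `^ (- b))%:E)%E.

(** The last hypothesis expresses homogeneity of degree [b]. Integrating the kernel in x first
    yields (1 + u)^(- b) by homogeneity, hence [kappa b r]. Integrating in u first yields a Gamma
    integral at scale [q x], hence [eGamma r] and the power - r of [q x]. *)
Lemma laplace_moment d (T : measurableType d)
    (nu : {sigma_finite_measure set T -> \bar R}) (v q : T -> R) (b r : R) :
  measurable_fun setT v -> measurable_fun setT q -> (forall x, 0 <= v x) ->
  (forall x, v x != 0 -> 0 < q x) ->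
  (forall l : R, (0 < l)%R -> \int[nu]_x (v x * expR (- (l * q x)))%:E =
     (l `^ (- b))%:E * \int[nu]_x (v x * expR (- q x))%:E)%E ->
  ((\int[nu]_x (v x * expR (- q x))%:E) * kappa b r =
   eGamma r * \int[nu]_x (v x * q x `^ (- r) * expR (- q x))%:E)%E.
Proof.
move=> mv mq v0 vq hl.
pose ind (u : R) : R := \1_pos u.
have mind : measurable_fun setT ind by exact: measurable_indic.
have ind0 u : 0 <= ind u by [].
have mfun (f : R -> R) : (\int[mu]_(u in pos) (f u)%:E = \int[mu]_u (ind u * f u)%:E)%E.
  rewrite integral_mkcond; apply: eq_integral => u _.
  by rewrite patchE /ind indicE; case: ifP => _; rewrite ?mul1r ?mul0r.
pose F (p : T * R) := (v p.1 * (ind p.2 * p.2 `^ (r - 1)) * expR (- ((1 + p.2) * q p.1)))%:E.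
have F0 p : (0 <= F p)%E.
  by rewrite lee_fin !mulr_ge0// ?powR_ge0 ?expR_ge0.
have mF : measurable_fun setT F.
  apply/measurable_EFinP; apply: measurable_funM.
    apply: measurable_funM; first exact: (measurableT_comp mv measurable_fst).
    apply: measurable_funM; first exact: (measurableT_comp mind measurable_snd).
    exact: (measurableT_comp (measurable_powR (r - 1)) measurable_snd).
  have mE : measurable_fun setT (fun p : T * R => - ((1 + p.2) * q p.1)).
    apply: measurable_funN; apply: measurable_funM.
      by apply: measurable_funD; [exact: measurable_cst|exact: measurable_snd].
    exact: (measurableT_comp mq measurable_fst).
  exact: (measurableT_comp (@measurable_expR R) mE).
have mexp l : measurable_fun setT (fun x => (v x * expR (- (l * q x)))%:E).
  apply/measurable_EFinP/measurable_funM => //.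
  have mE : measurable_fun setT (fun x => - (l * q x)).
    by apply: measurable_funN; apply: measurable_funM => //; exact: measurable_cst.
  exact: (measurableT_comp (@measurable_expR R) mE).
transitivity (\int[mu]_u \int[nu]_x F (x, u))%E.
  rewrite /kappa mfun -ge0_integralZl//; last 3 first.
  - apply/measurable_EFinP; apply: measurable_funM => //.
    apply: measurable_funM => //.
    have m1 : measurable_fun setT (fun u : R => 1 + u).
      by apply: measurable_funD => //; exact: measurable_cst.
    exact: (measurableT_comp (measurable_powR _) m1).
  - by move=> u _; rewrite lee_fin !mulr_ge0// ?powR_ge0.
  - by apply: integral_ge0 => x _; rewrite lee_fin mulr_ge0 ?expR_ge0.
  apply: eq_integral => u _; rewrite /F/=.
  have [u0|u0] := ltP 0 u; last first.
    have -> : ind u = 0.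
      by rewrite /ind indicE memNset//= in_itv/= andbT; apply/negP; rewrite -leNgt.
    rewrite mul0r mule0; under eq_integral do rewrite mul0r mulr0 mul0r.
    by rewrite integral0.
  have -> : ind u = 1 by rewrite /ind indicE mem_set//= in_itv/= andbT.
  rewrite !mul1r.
  under [RHS]eq_integral do rewrite mulrAC EFinM.
  rewrite ge0_integralZr//.
  - rewrite (hl _ (addr_gt0 ltr01 u0)); move: (\int[_]_x _)%E => I.
    by rewrite [RHS]muleAC -EFinM [LHS]muleC [in LHS]mulrC.
  - by move=> x _; rewrite lee_fin mulr_ge0 ?expR_ge0.
  - by rewrite lee_fin powR_ge0.
apply: etrans; first exact: (esym (fubini_tonelli (m1 := nu) (m2 := @lebesgue_measure R) F mF F0)).
rewrite -ge0_integralZl//.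
- apply: eq_integral => x _; rewrite /F/=.
  (* Positivity of [q x], needed to rescale the Gamma integral, is available only where [v x] is
     nonzero; elsewhere both sides vanish. *)
  have [->|vx0] := eqVneq (v x) 0.
    rewrite !mul0r mule0; under eq_integral do rewrite !mul0r.
    by rewrite integral0.
  have qx := vq _ vx0.
  transitivity (\int[mu]_u ((v x * expR (- q x))%:E *
      (ind u * (u `^ (r - 1) * expR (- (q x * u))))%:E))%E.
    apply: eq_integral => u _; rewrite -EFinM; congr EFin.
    rewrite mulrDl mul1r opprD expRD (mulrC u (q x)); ring.
  rewrite ge0_integralZl//.
  + rewrite -mfun eGamma_scale// muleA -EFinM [RHS]muleC; congr (_%:E * _)%E.
    by ring.
  + apply/measurable_EFinP/measurable_funM => //; apply/measurable_EFinP.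
    exact: measurable_powR_expR.
  + by move=> u _; rewrite lee_fin !mulr_ge0 ?powR_ge0 ?expR_ge0.
  + by rewrite lee_fin mulr_ge0 ?expR_ge0.
- apply/measurable_EFinP.
  under eq_fun do rewrite mulrAC.
  apply: measurable_funM; last exact: (measurableT_comp (measurable_powR _) mq).
  by have := mexp 1; under eq_fun do rewrite mul1r; move/measurable_EFinP.
- by move=> x _; rewrite lee_fin !mulr_ge0 ?powR_ge0 ?expR_ge0.
- apply: integral_ge0 => t _.
  by rewrite lee_fin !mulr_ge0 ?powR_ge0 ?expR_ge0.
Qed.

End gamma.

Section gamma_values.
Context {R : realType}.
Local Notation mu := (@lebesgue_measure R).
Local Notation pos := ([set` `]0, +oo[%R] : set R).

Lemma eGamma_ge0 (x : R) : (0 <= eGamma x)%E.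
Proof. by apply: integral_ge0 => t _; rewrite lee_fin mulr_ge0 ?powR_ge0 ?expR_ge0. Qed.

Lemma kappa_ge0 (b r : R) : (0 <= kappa b r)%E.
Proof. by apply: integral_ge0 => t _; rewrite lee_fin mulr_ge0 ?powR_ge0. Qed.

(** A Beta integral, obtained from [laplace_moment] on the half line with weight t^(b - 1) and q(t)
    = t. As an identity between extended reals it also transfers finiteness. *)
Lemma eGamma_kappa (b r : R) : (eGamma b * kappa b r = eGamma r * eGamma (b - r))%E.
Proof.
pose v (t : R) : R := \1_pos t * t `^ (b - 1).
have vE l f : (\int[mu]_(t in pos) (t `^ (b - 1) * f t * expR (- (l * t)))%:E =
    \int[mu]_t (v t * f t * expR (- (l * t)))%:E)%E.
  rewrite integral_mkcond; apply: eq_integral => t _.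
  by rewrite patchE /v indicE; case: ifP => _; rewrite ?mul1r ?mul0r.
have vE1 l : (\int[mu]_(t in pos) (t `^ (b - 1) * expR (- (l * t)))%:E =
    \int[mu]_t (v t * expR (- (l * t)))%:E)%E.
  have := vE l (fun=> 1).
  by under eq_integral do rewrite mulr1; under [X in _ = X -> _]eq_integral do rewrite mulr1.
have I1 : (\int[mu]_t (v t * expR (- t))%:E = eGamma b)%E.
  have := vE1 1; under eq_integral do rewrite mul1r.
  by under [X in _ = X -> _]eq_integral do rewrite mul1r.
have -> : eGamma (b - r) = (\int[mu]_t (v t * t `^ (- r) * expR (- t))%:E)%E.
  have := vE 1 (fun t => t `^ (- r)); under [X in _ = X -> _]eq_integral do rewrite mul1r.
  move=> <-; apply: eq_integral => t; rewrite inE/= in_itv/= andbT => t0.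
  by rewrite mul1r -powRD ?(gt_eqF t0) ?implybT//; congr (_ `^ _ * _)%:E; ring.
rewrite -I1; apply: (laplace_moment (nu := mu) (v := v) (q := id)) => //.
- apply: measurable_funM; first exact: measurable_indic.
  exact: measurable_powR.
- by move=> t; rewrite mulr_ge0// powR_ge0.
- move=> t; rewrite /v indicE; have [|_] := boolP (t \in _); last by rewrite mul0r eqxx.
  by rewrite inE/= in_itv/= andbT.
- by move=> l l0; rewrite I1 -vE1 eGamma_scale.
Qed.

(** This is the total mass of the exponential distribution. *)
Lemma eGamma1 : eGamma 1 = 1%E :> \bar R.
Proof.
apply: etrans (integral_exponential_pdf (ltr01 : 0 < 1 :> R)).
rewrite /eGamma; under eq_integral do rewrite subrr powRr0 mul1r.
rewrite integral_itv_obnd_cbnd; last first.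
  apply: measurable_funTS; have := @measurable_powR_expR R 0 1.
  by under eq_fun do rewrite powRr0 !mul1r.
rewrite integral_mkcond; apply: eq_integral => t _.
by rewrite /exponential_pdf !patchE; case: ifP => _; rewrite // mul1r mulN1r.
Qed.

(** Passes from a known product to its factors, which spares direct estimates of [kappa]. *)
Lemma mule_gt0_lty_inv (x y : \bar R) : (0 <= x)%E -> (0 <= y)%E ->
  (0 < x * y < +oo)%E -> (0 < x < +oo)%E /\ (0 < y < +oo)%E.
Proof.
move=> x0 y0 /andP[p0 py].
have xN0 : x != 0%E by apply: contraTneq p0 => ->; rewrite mul0e ltxx.
have yN0 : y != 0%E by apply: contraTneq p0 => ->; rewrite mule0 ltxx.
have xgt : (0 < x)%E by rewrite lt_def xN0.
have ygt : (0 < y)%E by rewrite lt_def yN0.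
rewrite xgt ygt/= !ltey; split; apply: contraTneq py => ->.
  by rewrite gt0_mulye.
by rewrite gt0_muley.
Qed.

Lemma mule_gt0_lty (x y : \bar R) : (0 < x < +oo)%E -> (0 < y < +oo)%E -> (0 < x * y < +oo)%E.
Proof.
by move=> /andP[x0 xy] /andP[y0 yy]; rewrite mule_gt0//= lte_mul_pinfty// ?ltW// ge0_fin_numE// ltW.
Qed.

(** In [eGamma_kappa] with b = x + y and r = x, the right side is the product of the two given
    values. *)
Lemma eGammaD_gt0_lty (x y : R) : (0 < eGamma x < +oo)%E -> (0 < eGamma y < +oo)%E ->
  (0 < eGamma (x + y) < +oo)%E /\ (0 < kappa (x + y) x < +oo)%E.
Proof.
move=> hx hy; apply: mule_gt0_lty_inv; [exact: eGamma_ge0|exact: kappa_ge0|].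
by rewrite eGamma_kappa (addrC x) addrK; exact: mule_gt0_lty.
Qed.

(** Starting value for the half-integers. From below, the integrand is at least exp(- 2) on the
    interval [1, 2]; from above, the square root of t is at most 1 + t, which bounds the integral by
    [eGamma 1 + eGamma (1 + 1)]. *)
Lemma eGamma_3half : (0 < eGamma (3 / 2 : R) < +oo)%E.
Proof.
have e1 : (0 < eGamma (1 : R) < +oo)%E by rewrite eGamma1 lte01 ltry.
have [e2 _] := eGammaD_gt0_lty e1 e1.
have m a : measurable_fun setT (fun t : R => (t `^ a * expR (- t))%:E).
  by have := @measurable_powR_expR R a 1; under eq_fun do rewrite mul1r.
have pe0 (a t : R) : (0 <= (t `^ a * expR (- t))%:E)%E.
  by rewrite lee_fin mulr_ge0 ?powR_ge0 ?expR_ge0.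
apply/andP; split.
  apply: (@lt_le_trans _ _ (\int[mu]_(t in `[1%R, 2%R]) (expR (- 2))%:E)%E).
    rewrite integral_cst//= lebesgue_measure_itv/= lte_fin ltrDl ltr01 -EFinB -EFinM lte_fin.
    by rewrite mulr_gt0 ?expR_gt0//; lra.
  apply: (@le_trans _ _ (\int[mu]_(t in `[1%R, 2%R]) (t `^ (3 / 2 - 1) * expR (- t))%:E)%E).
    apply: ge0_le_integral => //.
    - by apply: measurable_funTS; exact: m.
    - move=> t /=; rewrite in_itv/= => /andP[t1 t2]; rewrite lee_fin.
      rewrite -[leLHS]mul1r ler_pM ?expR_ge0// ?ler_expR ?lerN2//.
      have : t `^ 0 <= t `^ (3 / 2 - 1) by apply: ler_powR => //; lra.
      by rewrite powRr0.
  apply: ge0_subset_integral => //; first by apply: measurable_funTS; exact: m.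
  by move=> t /=; rewrite !in_itv/= andbT => /andP[t1 _]; lra.
apply: (@le_lt_trans _ _ (eGamma 1 + eGamma (1 + 1))%E); last first.
  by move: e1 e2 => /andP[_ ?] /andP[_ ?]; exact: lte_add_pinfty.
rewrite /eGamma -ge0_integralD//; [|by apply: measurable_funTS; exact: m..].
apply: ge0_le_integral => //.
- by apply: measurable_funTS; exact: m.
- by apply: emeasurable_funD; apply: measurable_funTS; exact: m.
- move=> t /=; rewrite in_itv/= andbT => t0; rewrite -EFinD lee_fin -mulrDl.
  rewrite ler_wpM2r ?expR_ge0// subrr powRr0 addrK powRr1 ?(ltW t0)//.
  have [t1|t1] := leP t 1.
    have : t `^ (3 / 2 - 1) <= t `^ 0 by apply: ger_powR; [rewrite t0 t1|lra].
    by rewrite powRr0 => /le_trans; apply; rewrite lerDl ltW.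
  have : t `^ (3 / 2 - 1) <= t `^ 1 by apply: ler_powR; lra.
  by rewrite powRr1 ?(ltW t0)// => /le_trans; apply; rewrite lerDr.
Qed.

End gamma_values.

(** * Gaussian radial moments and finiteness of Gamma at half-integers *)

Section norm_moments.
Context {R : realType}.

Lemma mx_set0_box m n : [set 0 : 'M[R]_(m, n)] = mx_box (fun _ _ => [set 0]).
Proof.
apply/seteqP; split=> M /=; first by move=> -> i j; rewrite mxE.
by move=> h; apply/matrixP => i j; rewrite mxE h.
Qed.

Lemma measurable_mx_set0 m n : measurable [set 0 : 'M[R]_(m, n)].
Proof. by rewrite mx_set0_box; exact: measurable_mx_box. Qed.

Lemma lebesgue_mx_set0 m n : @lebesgue_mx R m.+1 n.+1 [set 0] = 0%E.
Proof.
rewrite mx_set0_box lebesgue_mx_box// big_ord_recl big_ord_recl lebesgue_measure_set1.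
by rewrite !mul0e.
Qed.

Lemma measurable_frobenius2 m n :
  measurable_fun setT (fun a : 'M[R]_(m, n) => frobenius a / 2).
Proof.
by apply: measurable_funM; [exact: measurable_frobenius|exact: measurable_cst].
Qed.

Lemma measurable_norm_powR_expR m n (r l : R) :
  measurable_fun setT (fun a : 'M[R]_(m, n) =>
    ((frobenius a / 2) `^ r * expR (- (l * (frobenius a / 2))))%:E).
Proof.
have := measurableT_comp (measurable_powR_expR r l) (@measurable_frobenius2 m n).
exact.
Qed.

Lemma integral_expR_frobenius m n :
  (\int[@lebesgue_mx R m n]_a (expR (- (frobenius a / 2)))%:E =
   (Num.sqrt (2 * pi) ^+ (m * n))%:E)%E.
Proof.
have c0 : 0 < Num.sqrt (2 * pi) ^+ (m * n) :> R.
  by rewrite exprn_gt0// sqrtr_gt0 mulr_gt0// pi_gt0.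
transitivity (\int[@lebesgue_mx R m n]_a
    ((Num.sqrt (2 * pi) ^+ (m * n))%:E * (gauss a)%:E))%E.
  apply: eq_integral => a _; rewrite gaussE -EFinM mulrA divff ?gt_eqF// mul1r.
  by rewrite mulNr.
rewrite ge0_integralZl//.
- by rewrite integral_gauss mule1.
- by apply/measurable_EFinP; exact: measurable_gauss.
- by move=> a _; rewrite lee_fin gauss_ge0.
Qed.

(** This is [laplace_moment] with q(a) = |a|^2 / 2 and weight q^r: the weight cancels against the
    power - r of q, leaving the Gaussian integral on the right. *)
Lemma norm_laplace n (r : R) : 0 < r ->
  ((\int[@lebesgue_mx R n.+1 1]_a
     ((frobenius a / 2) `^ r * expR (- (frobenius a / 2)))%:E)
   * kappa (n.+1%:R / 2 + r) r =
   eGamma r * (Num.sqrt (2 * pi) ^+ n.+1)%:E)%E.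
Proof.
move=> r0.
pose q (a : 'M[R]_(n.+1, 1)) := frobenius a / 2.
have q0 a : 0 <= q a by rewrite divr_ge0// frobenius_ge0.
have mq : measurable_fun setT q by exact: measurable_frobenius2.
have mv : measurable_fun setT (fun a => q a `^ r).
  exact: (measurableT_comp (measurable_powR r) mq).
rewrite (laplace_moment (v := fun a => q a `^ r) (q := q) (nu := @lebesgue_mx R n.+1 1))//.
- congr (_ * _)%E; rewrite -[in RHS](muln1 n.+1) -integral_expR_frobenius.
  (* The cancellation fails only at the origin, where 0 to the power [r] is 0; this point is null
     because the dimension is positive. *)
  apply: ge0_ae_eq_integral => //.
  + apply/measurable_EFinP/measurable_funM.
      by apply: measurable_funM => //; exact: (measurableT_comp (measurable_powR (- r)) mq).
    by apply: (measurableT_comp (@measurable_expR R)); exact: measurable_funN.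
  + apply/measurable_EFinP; apply: (measurableT_comp (@measurable_expR R)).
    exact: measurable_funN.
  + by move=> a _; rewrite lee_fin !mulr_ge0 ?powR_ge0 ?expR_ge0.
  + exists [set 0]; split.
    * exact: measurable_mx_set0.
    * exact: lebesgue_mx_set0.
    * move=> a /= h; apply/eqP; rewrite -frobenius_eq0; apply/eqP.
      apply: contrapT => /eqP fa; apply: h => _.
      have qa : q a != 0 by rewrite mulf_neq0// invr_eq0.
      by rewrite powRN divff ?mul1r// powR_eq0 (negbTE qa).
- by move=> a; exact: powR_ge0.
- by move=> a; rewrite powR_eq0 negb_and (gt_eqF r0) orbF lt_def q0 andbT.
(* Homogeneity: scaling [a] by the square root of [l] multiplies q by [l] and volume by l^((n + 1) /
   2), so the degree is (n + 1) / 2 + r. *)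
- move=> l l0.
  have sl : 0 < Num.sqrt l by rewrite sqrtr_gt0.
  have us : (Num.sqrt l)%:M \in @unitmx R n.+1.
    by rewrite unitmxE det_scalar unitrX// unitfE gt_eqF.
  have mI k : measurable_fun setT (fun a => (q a `^ r * expR (- (k * q a)))%:E).
    exact: measurable_norm_powR_expR.
  have I0 k a : (0 <= (q a `^ r * expR (- (k * q a)))%:E)%E.
    by rewrite lee_fin mulr_ge0 ?powR_ge0 ?expR_ge0.
  under [in RHS]eq_integral do rewrite -[X in expR (- X)]mul1r.
  rewrite (integral_mulmxl us (mI 1) (I0 1)).
  rewrite det_scalar expr1 ger0_norm ?exprn_ge0 ?ltW//.
  rewrite muleA -EFinM -ge0_integralZl//; last first.
  + by rewrite lee_fin mulr_ge0 ?powR_ge0 ?exprn_ge0 ?ltW.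
  + apply: (measurableT_comp (mI 1)).
    by apply: measurable_mulmx; [exact: measurable_cst|exact: measurable_id].
  apply: eq_integral => a _; rewrite -EFinM; congr EFin.
  have -> : q ((Num.sqrt l)%:M *m a) = l * q a.
    by rewrite /q mul_scalar_mx frobenius_scale sqr_sqrtr ?ltW// mulrA.
  rewrite mul1r powRM ?(ltW l0)// !mulrA -[LHS]mul1r !mulrA; congr (_ * _ * _).
  rewrite -powR12_sqrt ?ltW// -powR_mulrn ?powR_ge0// -powRrM -!powRD ?(gt_eqF l0) ?implybT//.
  by rewrite (_ : _ + r = 0) ?powRr0//; field.
Qed.

(** For 1 / 2, the Gaussian identity in dimension 1 with r = 1 controls [kappa (3 / 2) 1], and
    [eGamma_kappa] identifies its product with [eGamma (3 / 2)] as [eGamma (1 / 2)]. Further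
    half-integers follow by adding 1 / 2 repeatedly. *)
Lemma eGamma_half n : (0 < eGamma (n.+1%:R / 2 : R) < +oo)%E.
Proof.
have e1 : (0 < eGamma (1 : R) < +oo)%E by rewrite eGamma1 lte01 ltry.
have e12 : (0 < eGamma (1 / 2 : R) < +oo)%E.
  have h1 := @norm_laplace 0 1 ltr01.
  have [||_ hk] := @mule_gt0_lty_inv R (\int[@lebesgue_mx R 1 1]_a
     ((frobenius a / 2) `^ 1 * expR (- (frobenius a / 2)))%:E)%E
     (kappa (1 / 2 + 1) 1) _ (kappa_ge0 _ _).
  - by apply: integral_ge0 => a _; rewrite lee_fin mulr_ge0 ?powR_ge0 ?expR_ge0.
  - rewrite h1; apply: mule_gt0_lty => //.
    by rewrite lte_fin exprn_gt0 ?ltry// sqrtr_gt0 mulr_gt0// pi_gt0.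
  have h2 : (eGamma (3 / 2) * kappa (3 / 2) 1 = eGamma 1 * eGamma (3 / 2 - 1) :> \bar R)%E.
    exact: eGamma_kappa.
  have -> : 1 / 2 = 3 / 2 - 1 :> R by field.
  rewrite -[X in (_ < X < _)%E]mul1e -eGamma1 -h2.
  rewrite (_ : 3 / 2 = 1 / 2 + 1) in h2 *; last by field.
  apply: (mule_gt0_lty _ hk); rewrite (_ : 1 / 2 + 1 = 3 / 2); last by field.
  exact: eGamma_3half.
elim: n => [//|n IH].
by have [] := eGammaD_gt0_lty IH e12; rewrite -mulrDl natr1.
Qed.

End norm_moments.

(** * Absolute moments of the determinant and almost sure invertibility *)

Section det_moment_values.
Context {R : realType}.

Lemma Gamma_half_gt0 n : 0 < Gamma (n.+1%:R / 2 : R).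
Proof. by rewrite GammaE fine_gt0// eGamma_half. Qed.

Lemma eGamma_halfE n : eGamma (n.+1%:R / 2 : R) = (Gamma (n.+1%:R / 2 : R))%:E.
Proof.
rewrite GammaE fineK// ge0_fin_numE ?eGamma_ge0//.
by have /andP[] := @eGamma_half R n.
Qed.

(** With r = s / 2 and b = (n + 1 + s) / 2, both [norm_laplace] and [eGamma_kappa] contain the same
    [kappa b r] and the same [eGamma r]; eliminating them leaves the Gamma quotient. The power of 2
    comes from |a|^s = 2^r (|a|^2 / 2)^r. *)
Lemma norm_moment_pow n s : (0 < s)%N ->
  norm_moment (fun x : R => `|x| ^+ s) n.+1 =
  (2 `^ (s%:R / 2) * (Gamma ((n.+1 + s)%:R / 2) / Gamma (n.+1%:R / 2)))%:E.
Proof.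
case: s => // s _.
set r : R := s.+1%:R / 2.
have r0 : 0 < r by rewrite divr_gt0.
have c0 : 0 < Num.sqrt (2 * pi) ^+ n.+1 :> R.
  by rewrite exprn_gt0// sqrtr_gt0 mulr_gt0// pi_gt0.
set c := Num.sqrt (2 * pi) ^+ n.+1 in c0.
have := norm_laplace n r0; rewrite -/c.
set I := (\int[_]_a _)%E => hI.
have -> : norm_moment (fun x : R => `|x| ^+ s.+1) n.+1 = ((2 `^ r / c)%:E * I)%E.
  rewrite /I -ge0_integralZl//.
  - apply: eq_integral => a _; rewrite -EFinM; congr EFin.
    rewrite gaussE muln1 -/c ger0_norm ?sqrtr_ge0// -powR_mulrn ?sqrtr_ge0//.
    rewrite -powR12_sqrt ?frobenius_ge0// -powRrM [2^-1 * _]mulrC -/r mulNr.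
    have q0 : 0 <= frobenius a / 2 by rewrite divr_ge0 ?frobenius_ge0.
    have -> : frobenius a `^ r = 2 `^ r * (frobenius a / 2) `^ r.
      by rewrite -powRM// mulrC divfK.
    move: (expR _) (powR (_ / 2) _) (powR 2 r) => x y z.
    by ring.
  - have := @measurable_norm_powR_expR R n.+1 1 r 1.
    by under eq_fun do rewrite mul1r.
  - by move=> a _; rewrite lee_fin mulr_ge0 ?powR_ge0 ?expR_ge0.
  - by rewrite lee_fin divr_ge0 ?powR_ge0 ?ltW.
have hG := eGamma_kappa (n.+1%:R / 2 + r) r.
have e : n.+1%:R / 2 + r = (n.+1 + s).+1%:R / 2 by rewrite -mulrDl -natrD addnS.
rewrite addrK e in hG; rewrite e in hI.
have I0 : (0 <= I)%E.
  by apply: integral_ge0 => a _; rewrite lee_fin mulr_ge0 ?powR_ge0 ?expR_ge0.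
have [||/andP[Igt Iy] /andP[kgt ky]] := @mule_gt0_lty_inv R I
  (kappa ((n.+1 + s).+1%:R / 2) r) _ (kappa_ge0 _ _) _ => //.
  rewrite hI; apply: mule_gt0_lty; first exact: eGamma_half.
  by rewrite lte_fin c0 ltry.
rewrite addnS !eGamma_halfE in hG *; rewrite !eGamma_halfE in hI.
have IE : I = (fine I)%:E by rewrite fineK// ge0_fin_numE.
have kE : kappa ((n.+1 + s).+1%:R / 2) r = (fine (kappa ((n.+1 + s).+1%:R / 2) r))%:E.
  by rewrite fineK// ge0_fin_numE ?kappa_ge0.
move: hI hG kgt; rewrite IE kE -!EFinM lte_fin => -[hI] [hG] k0.
congr EFin; set k := fine (kappa _ _) in hI hG k0.
have k1 := gt_eqF k0; have c1 := gt_eqF c0; have G1 := gt_eqF (Gamma_half_gt0 n).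
(* After multiplication by [k], which is finite and positive, both identities can be substituted. *)
apply: (mulIf (negbT k1)).
rewrite -[LHS]mulrA hI -[RHS]mulrA -(mulrA (Gamma _)) [_^-1 * _]mulrC (mulrA (Gamma _)) hG.
by field; rewrite ?c1 ?G1.
Qed.

(** The expectation of |det A|^N for a Gaussian matrix [A] of size [N], with the Gamma arguments
    already in the form of the final density. *)
Definition det_const N : R :=
  \prod_(0 <= k < N) (2 `^ (N%:R / 2) * (Gamma ((N%:R + 1) / 2 + k%:R / 2) / Gamma ((k%:R + 1) / 2))).

Lemma det_moment_pow N : det_moment (fun x : R => `|x| ^+ N) N = (det_const N)%:E.
Proof.
rewrite det_moment_prod//.
- rewrite normr1 expr1n mul1e /det_const big_mkord -prodEFin.
  (* The positivity condition on the exponent [N] follows from the existence of an index [k] below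
     [N]. *)
  apply: eq_bigr => k _; rewrite norm_moment_pow; last by case: N k => // -[].
  have -> : (k.+1 + N)%:R / 2 = (N%:R + 1) / 2 + k%:R / 2 :> R.
    by rewrite -mulrDl natr1 -natrD addSnnS addnC.
  by rewrite -[k.+1%:R]natr1.
- apply: measurable_funX; exact: normr_measurable.
- by move=> x y; rewrite normrM exprMn.
- by move=> x; rewrite normrN.
Qed.

Lemma measurable_neq0 : measurable_fun setT (fun x : R => (x != 0)%:R : R).
Proof.
rewrite (_ : (fun _ => _) = (fun x : R => if x == 0 then 0 else 1)).
  apply: measurable_fun_ifT; [|exact: measurable_cst..].
  by apply: measurable_fun_eqr; [exact: measurable_id|exact: measurable_cst].
by apply/funext => x; case: eqP.
Qed.

Lemma norm_moment_nonzero n : norm_moment (fun x : R => (x != 0)%:R) n.+1 = 1%E.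
Proof.
rewrite -[RHS](@integral_gauss R n.+1 1).
have mg : measurable_fun setT (@gauss R n.+1 1) by exact: measurable_gauss.
have ms : measurable_fun setT (fun a : 'M[R]_(n.+1, 1) => Num.sqrt (frobenius a)).
  under eq_fun do rewrite -powR12_sqrt ?frobenius_ge0//.
  apply: (measurableT_comp (measurable_powR _)).
  exact: measurable_frobenius.
apply: ge0_ae_eq_integral => //.
- apply/measurable_EFinP/measurable_funM => //.
  exact: (measurableT_comp measurable_neq0 ms).
- exact/measurable_EFinP.
- by move=> a _; rewrite lee_fin mulr_ge0// gauss_ge0.
- by move=> a _; rewrite lee_fin gauss_ge0.
- exists [set 0]; split; [exact: measurable_mx_set0|exact: lebesgue_mx_set0|].
  move=> a /= h; apply/eqP; rewrite -frobenius_eq0; apply/eqP.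
  apply: contrapT => /eqP fa; apply: h => _.
  by rewrite sqrtr_eq0 -ltNge lt_def fa frobenius_ge0 mul1r.
Qed.

Lemma det_moment_nonzero n : det_moment (fun x : R => (x != 0)%:R) n = 1%E.
Proof.
rewrite det_moment_prod.
- by rewrite oner_neq0 mul1e big1// => k _; exact: norm_moment_nonzero.
- exact: measurable_neq0.
- by move=> x.
- by move=> x y; rewrite mulf_eq0 negb_or; case: eqP; case: eqP; rewrite ?mulr0 ?mul0r ?mulr1.
- by move=> x; rewrite oppr_eq0.
Qed.

(** By [det_moment_nonzero] the invertible matrices carry the full Gaussian mass. The Gaussian
    density is positive everywhere, so a set of zero Gaussian mass is Lebesgue null. *)
Lemma ae_det_neq0 n : {ae @lebesgue_mx R n n, forall A, \det A != 0}.
Proof.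
have mg : measurable_fun setT (@gauss R n n) by exact: measurable_gauss.
have md : measurable_fun setT (fun A : 'M[R]_n => \det A).
  by apply: measurable_det; exact: measurable_id.
have mI : measurable_fun setT (fun A : 'M[R]_n => (\det A != 0)%:R : R).
  exact: (measurableT_comp measurable_neq0 md).
pose f (A : 'M[R]_n) : \bar R := ((\det A == 0)%:R * gauss A)%:E.
have f0 A : (0 <= f A)%E by rewrite lee_fin mulr_ge0// gauss_ge0.
have fE A : f A = ((1 - (\det A != 0)%:R) * gauss A)%:E.
  by rewrite /f; case: eqP => _; rewrite ?subr0 ?subrr.
have mf : measurable_fun setT f.
  rewrite (funext fE).
  apply/measurable_EFinP/measurable_funM => //.
  by apply: measurable_funB => //; exact: measurable_cst.
have : (\int[@lebesgue_mx R n n]_A `|f A| = 0)%E.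
  (* The masses of singular and of invertible matrices add up to 1, and the second is already 1. *)
  have : (\int[@lebesgue_mx R n n]_A (f A + ((\det A != 0)%:R * gauss A)%:E) = 1)%E.
    rewrite -[RHS](@integral_gauss R n n); apply: eq_integral => A _.
    by rewrite fE -EFinD -mulrDl subrK mul1r.
  rewrite ge0_integralD//.
  - have := det_moment_nonzero n; rewrite /det_moment => ->.
    under [X in _ -> X = _]eq_integral do rewrite gee0_abs//.
    case: (\int[_]_A f A)%E => [x| |]//= [] h.
    by congr EFin; apply: (addIr (1 : R)); rewrite h add0r.
  - by move=> A _; rewrite lee_fin mulr_ge0// gauss_ge0.
  - exact/measurable_EFinP/measurable_funM.
move=> /(ae_eq_integral_abs _ measurableT mf)[Z [mZ Z0 hZ]].
exists Z; split => // A /= hA; apply: hZ => /= /(_ I).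
move: hA => /negP; rewrite negbK => /eqP dA.
by rewrite /f dA eqxx mul1r => -[] /eqP; rewrite gt_eqF// gauss_gt0.
Qed.

End det_moment_values.

(** * The density *)

(** Induction on the size through the Schur complement of the top left entry, which is again
    symmetric and positive definite. *)
Lemma cholesky (R : rcfType) n (M : 'M[R]_n) : M^T = M ->
  (forall x : 'rV_n, x != 0 -> 0 < \tr (x *m M *m x^T)) ->
  exists S : 'M[R]_n, S *m S^T = M.
Proof.
elim: n M => [|n IH] M MT pos.
  by exists 0; apply/matrixP => -[].
pose M' : 'M[R]_(1 + n) := M.
have [M'T M'pos] : M'^T = M' /\ (forall x : 'rV_(1 + n), x != 0 -> 0 < \tr (x *m M' *m x^T)).
  by [].
suff : exists S : 'M[R]_(1 + n), S *m S^T = M' by [].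
clearbody M'; clear M MT pos.
pose a := M' 0 0; pose b : 'cV_n := dlsubmx M'; pose C : 'M[R]_n := drsubmx M'.
have Ma : ulsubmx M' = a%:M.
  by apply/matrixP => i j; rewrite !ord1 !mxE eqxx/=; congr (M' _ _); exact: val_inj.
have Mb : ursubmx M' = b^T by rewrite /b trmx_dlsub M'T.
have ME : M' = block_mx a%:M b^T b C by rewrite -Ma -Mb submxK.
have CT : C^T = C by rewrite /C trmx_drsub M'T.
have a0 : 0 < a.
  have := M'pos (row_mx 1%:M 0).
  rewrite {1}ME mul_row_block tr_row_mx mul_row_col trmx1 trmx0 !mul1mx !mul0mx mulmx0.
  rewrite mulmx1 !addr0 mxtrace_scalar mulr1n; apply.
  apply/eqP => /(congr1 lsubmx); rewrite row_mxKl linear0 => /matrixP/(_ 0 0).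
  by rewrite !mxE eqxx => /eqP; rewrite oner_eq0.
have [S SE] : exists S : 'M[R]_n, S *m S^T = C - a^-1 *: (b *m b^T).
  apply: IH => [|y y0].
    by rewrite linearB/= CT linearZ/= trmx_mul trmxK.
  (* This first coordinate makes the first block of (t, y) M' vanish, so the form of [M'] at (t, y)
     equals the form of the Schur complement at [y]. *)
  pose t := - (a^-1 *: (y *m b)).
  have := M'pos (row_mx t y); rewrite {1}ME mul_row_block tr_row_mx mul_row_col.
  rewrite (_ : t *m a%:M + y *m b = 0); last first.
    by rewrite mul_mx_scalar /t scalerN scalerA divff ?gt_eqF// scale1r addNr.
  rewrite mul0mx add0r (_ : t *m b^T + y *m C = y *m (C - a^-1 *: (b *m b^T))); last first.
    by rewrite mulmxBr /t mulNmx -scalemxAl -scalemxAr mulmxA addrC.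
  apply; apply: contraNneq y0 => /(congr1 rsubmx); rewrite row_mxKr linear0 => ->.
  by rewrite eqxx.
(* The block b / sqrt(a) reproduces the off-diagonal blocks, and its Gram matrix restores the term
   subtracted in the Schur complement. *)
exists (block_mx (Num.sqrt a)%:M 0 ((Num.sqrt a)^-1 *: b) S).
have sa : Num.sqrt a != 0 by rewrite gt_eqF// sqrtr_gt0.
rewrite ME tr_block_mx mulmx_block !trmx0 !mulmx0 !mul0mx !addr0 tr_scalar_mx SE.
rewrite -scalar_mxM -expr2 sqr_sqrtr ?ltW// linearZ/= mul_scalar_mx scalerA divff// scale1r.
rewrite mul_mx_scalar scalerA divff// scale1r; congr block_mx.
rewrite -scalemxAl -scalemxAr scalerA -invfM -expr2 sqr_sqrtr ?ltW//.
by rewrite addrC subrK.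
Qed.

Section matrix_integral.
Context {R : realType}.

(** The quadratic form at x is |x|^2 + |x Y|^2, hence positive definite. A nonzero vector in the
    left kernel of [S] would make it vanish, so [S] is invertible. *)
Lemma one_plus_gram_factor n (Y : 'M[R]_n) :
  exists2 S : 'M[R]_n, S *m S^T = 1%:M + Y *m Y^T & S \in unitmx.
Proof.
have pos (x : 'rV[R]_n) : x != 0 -> 0 < \tr (x *m (1%:M + Y *m Y^T) *m x^T).
  move=> x0; rewrite mulmxDr mulmx1 mulmxDl mxtraceD.
  rewrite (_ : x *m (Y *m Y^T) *m x^T = (x *m Y) *m (x *m Y)^T); last first.
    by rewrite trmx_mul !mulmxA.
  rewrite ltr_pwDl ?frobenius_ge0// lt_def frobenius_ge0 andbT.
  by rewrite frobenius_eq0.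
have [|//|S SE] := @cholesky R n (1%:M + Y *m Y^T).
  by rewrite linearD/= trmx1 trmx_mul trmxK.
exists S => //; rewrite -row_free_unit -kermx_eq0.
apply/negPn/negP => /rowV0Pn[x /sub_kermxP xS x0].
by have := pos x x0; rewrite -SE mulmxA xS !mul0mx mxtrace0 ltxx.
Qed.

Lemma det_one_plus_gram_gt0 n (Y : 'M[R]_n) : 0 < \det (1%:M + Y *m Y^T).
Proof.
have [S <- uS] := one_plus_gram_factor Y.
by rewrite det_mulmx det_tr -expr2 exprn_even_gt0//=; move: uS; rewrite unitmxE unitfE.
Qed.

(** Passing from [A] to [A *m S] costs |det S|^(- n) for the Jacobian and |det S|^(- n) for the
    power of the determinant; together they give det(1 + Y Y^T)^(- n). *)
Lemma integral_det_gauss_mul n (Y : 'M[R]_n) :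
  (\int[@lebesgue_mx R n n]_A (`|\det A| ^+ n * (gauss A * gauss (A *m Y)))%:E =
   (Num.sqrt (2 * pi) ^- (n * n) * det_const n * \det (1%:M + Y *m Y^T) ^- n)%:E)%E.
Proof.
have [S SE uS] := one_plus_gram_factor Y.
set c := Num.sqrt (2 * pi) ^- (n * n).
have c0 : 0 <= c by rewrite invr_ge0 exprn_ge0// sqrtr_ge0.
have dS : 0 < `|\det S| by rewrite normr_gt0; move: uS; rewrite unitmxE unitfE.
have mid := @measurable_id _ 'M[R]_n setT.
have md : measurable_fun setT (fun A : 'M[R]_n => `|\det A| ^+ n).
  apply: measurable_funX; apply: (measurableT_comp (@normr_measurable R setT)).
  exact: measurable_det.
have mf : measurable_fun setT (fun A : 'M[R]_n => (`|\det A| ^+ n * gauss A)%:E).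
  by apply/measurable_EFinP/measurable_funM => //; exact: measurable_gauss.
have f0 (A : 'M[R]_n) : (0 <= (`|\det A| ^+ n * gauss A)%:E)%E.
  by rewrite lee_fin mulr_ge0 ?exprn_ge0// gauss_ge0.
have := integral_mulmxr uS mf f0.
rewrite -[LHS]/(det_moment (fun x : R => `|x| ^+ n) n) det_moment_pow.
set I := (X in (_ * X)%E) => hI.
have -> : (\int[@lebesgue_mx R n n]_A (`|\det A| ^+ n * (gauss A * gauss (A *m Y)))%:E =
    (c * `|\det S| ^- n)%:E * I)%E.
  have mG : measurable_fun setT
      (fun A : 'M[R]_n => (`|\det (A *m S)| ^+ n * gauss (A *m S))%:E).
    by apply: (measurableT_comp mf); apply: measurable_mulmx => //; exact: measurable_cst.
  have k0 : (0 <= (c * `|\det S| ^- n)%:E)%E.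
    by rewrite lee_fin mulr_ge0// invr_ge0 exprn_ge0.
  rewrite /I -(ge0_integralZl (@lebesgue_mx R n n) measurableT mG (fun A _ => f0 (A *m S)) k0).
  apply: eq_integral => A _; rewrite -EFinM; congr EFin.
  (* Since S S^T = 1 + Y Y^T, the two Gaussian exponents merge into one, and only one of the two
     normalising constants is absorbed by [gauss (A *m S)]. *)
  have fS : frobenius (A *m S) = frobenius A + frobenius (A *m Y).
    rewrite /frobenius !trmx_mul !mulmxA -(mulmxA A S) SE mulmxDr mulmx1 mulmxDl mxtraceD.
    by rewrite !mulmxA.
  have -> : gauss A * gauss (A *m Y) = c * gauss (A *m S).
    by rewrite !gaussE -/c fS opprD mulrDl expRD mulrACA -mulrA.
  rewrite det_mulmx normrM exprMn.
  move: (gauss _) => x; have : `|\det S| ^+ n != 0 by rewrite gt_eqF// exprn_gt0.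
  by move: (`|\det S| ^+ n) => y y0; field.
have dN : `|\det S| ^+ n != 0 by rewrite gt_eqF// exprn_gt0.
have -> : I = ((`|\det S| ^- n)%:E * (det_const n)%:E)%E.
  by rewrite hI muleA -EFinM mulVf// mul1e.
rewrite -!EFinM -SE det_mulmx det_tr exprMn.
rewrite (_ : \det S ^+ n * \det S ^+ n = `|\det S| ^+ n * `|\det S| ^+ n); last first.
  by rewrite -!exprMn -expr2 -[in RHS]expr2 real_normK ?num_real.
by congr EFin; field.
Qed.

(** The [n] factors 2^(n / 2) in [det_const n] cancel the power of 2 in (2 pi)^(- n^2 / 2). *)
Lemma density_constant n :
  Num.sqrt (2 * pi) ^- (n * n) * det_const n =
  pi `^ (- (n%:R ^+ 2 / 2)) *
  (\prod_(0 <= j < n)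
     (Gamma ((n%:R + 1) / 2 + j%:R / 2) / Gamma ((j%:R + 1) / 2))) :> R.
Proof.
rewrite /det_const big_split/= mulrA; congr (_ * _).
have p0 : 0 < pi :> R by exact: pi_gt0.
rewrite prodr_const_nat subn0 -powR_mulrn ?powR_ge0// -powRrM.
rewrite -powR12_sqrt ?mulr_ge0 ?pi_ge0// -powR_mulrn ?powR_ge0// -powRrM -powRN.
rewrite powRM ?pi_ge0// mulrAC -powRD ?implybT ?pnatr_eq0//.
rewrite natrM (_ : _ + _ = 0) ?powRr0 ?mul1r; last by field.
by congr (_ `^ _); field.
by rewrite implybT.
Qed.

End matrix_integral.

(** * Laws of one and of two independent Ginibre matrices *)

Section ginibre.
Context {R : realType} {d : measure_display} {T : measurableType d} (P : probability T R).

Lemma integral_gauss_box m n (A : 'I_m -> 'I_n -> set R) :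
  (forall i j, measurable (A i j)) ->
  (\int[@lebesgue_mx R m n]_(M in mx_box A) (gauss M)%:E =
   \prod_(i < m) \prod_(j < n) normal_prob 0 1 (A i j))%E.
Proof.
move=> mA; pose f i j (x : R) : \bar R := (\1_(A i j) x * normal_pdf 0 1 x)%:E.
transitivity (\prod_(i < m) \prod_(j < n) \int[lebesgue_measure]_x f i j x)%E; last first.
  apply: eq_bigr => i _; apply: eq_bigr => j _.
  rewrite /normal_prob/= [RHS]integral_mkcond; apply: eq_integral => x _.
  by rewrite patchE /f indicE; case: ifP => _; rewrite ?mul1r ?mul0r.
rewrite -integral_lebesgue_mx_prod.
- rewrite integral_mkcond; apply: eq_integral => M _; rewrite patchE.
  under eq_bigr do rewrite prodEFin.
  rewrite prodEFin; case: ifPn => [|/negP hM].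
    rewrite inE => hM; congr EFin; apply: eq_bigr => i _; apply: eq_bigr => j _.
    by rewrite indicE mem_set ?mul1r.
  have [i [j hij]] : exists i j, ~ A i j (M i j).
    apply: contrapT => h; apply: hM; rewrite inE => i j.
    by apply: contrapT => hij; apply: h; exists i, j.
  rewrite (bigD1 i)//= (bigD1 j)//= indicE memNset// mul0r mul0r mul0r.
  by [].
- move=> i j; apply/measurable_EFinP/measurable_funM; last exact: measurable_normal_pdf.
  exact: measurable_indic.
- by move=> i j x; rewrite lee_fin mulr_ge0// normal_pdf_ge0.
Qed.

(** Independence over the full index set makes the probability of a box a product of Gaussian
    probabilities, and boxes determine the law. *)
Lemma ginibre_law N (A : {RV P >-> 'M[R]_N}) (E : set 'M[R]_N) :
  real_ginibre P A -> measurable E ->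
  P (A @^-1` E) = (\int[lebesgue_mx]_(M in E) (gauss M)%:E)%E.
Proof.
move=> [Ag Ai] mE.
have [nu nuE] := density_measure_exists (@lebesgue_mx R N N) (@measurable_gauss R N N) (@gauss_ge0 R N N).
have mA : measurable_fun setT A by exact: measurable_funPT.
pose muA := pushforward_measure P mA.
rewrite -nuE//; apply: (@measure_mx_unique _ _ _ muA nu) => // [F mF|k].
- rewrite nuE; last exact: measurable_mx_box.
  rewrite integral_gauss_box// /muA/= /pushforward pair_big/=.
  have := Ai [set: 'I_N * 'I_N]%SET (fun k => F k.1 k.2) (fun k => mF k.1 k.2).
  rewrite (_ : \bigcap_(i in _) _ = A @^-1` mx_box F); last first.
    apply/seteqP; split=> w /=.
      by move=> h i j; apply: (h (i, j)); rewrite /= inE.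
    by move=> h [i j] _; exact: h.
  move=> ->; apply: eq_big => [k|k _]; first by rewrite inE.
  exact: Ag.
- rewrite /muA/= /pushforward (le_lt_trans _ (ltry 1))// probability_le1//.
  by rewrite -[X in measurable X]setTI; apply: (measurable_funPT A) => //; exact: measurable_mx_box.
Qed.

(** The joint law and the measure with the product density both agree on rectangles with the product
    of the two distributions, hence both equal it. *)
Lemma ginibre_pair_law N (A B : {RV P >-> 'M[R]_N}) (Z : set ('M[R]_N * 'M[R]_N)) :
  real_ginibre P A -> real_ginibre P B -> independent P A B -> measurable Z ->
  P ((fun w => (A w, B w)) @^-1` Z) =
  (\int[lebesgue_mx]_M \int[lebesgue_mx]_M' (\1_Z (M, M') * (gauss M * gauss M'))%:E)%E.
Proof.
move=> hA hB hAB mZ.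
have mA : measurable_fun setT A by exact: measurable_funPT.
have mB : measurable_fun setT B by exact: measurable_funPT.
have mAB : measurable_fun setT (fun w => (A w, B w)) by exact: measurable_fun_pair.
have mg := @measurable_gauss R N N.
pose g (p : 'M[R]_N * 'M[R]_N) := gauss p.1 * gauss p.2.
have mgg : measurable_fun setT g.
  apply: measurable_funM.
    exact: (measurableT_comp mg measurable_fst).
  exact: (measurableT_comp mg measurable_snd).
have gg0 p : 0 <= g p by rewrite mulr_ge0// gauss_ge0.
pose lam2 : {measure set ('M[R]_N * 'M[R]_N) -> \bar R} :=
  Measure.clone _ _ _ (@lebesgue_mx R N N \x @lebesgue_mx R N N)%E _.
have [nu nuE] := density_measure_exists lam2 mgg gg0.
have nuX (X : set ('M[R]_N * 'M[R]_N)) : measurable X -> nu X =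
    (\int[lebesgue_mx]_M \int[lebesgue_mx]_M' (\1_X (M, M') * (gauss M * gauss M'))%:E)%E.
  move=> mX; rewrite nuE//.
  rewrite -(fubini_tonelli1 (fun p => (\1_X p * g p)%:E)).
  - rewrite integral_mkcond; apply: eq_integral => p _.
    by rewrite patchE indicE; case: ifP => _; rewrite ?mul1r ?mul0r.
  - by apply/measurable_EFinP/measurable_funM => //; exact: measurable_indic.
  - by move=> p; rewrite lee_fin mulr_ge0.
rewrite -nuX//.
pose PA := distribution P A; pose PB := distribution P B.
pose muAB := pushforward_measure P mAB.
transitivity ((PA \x PB)%E Z).
  by apply/esym/(@product_measure_unique _ _ _ _ _ PA PB muAB) => // E F; exact: hAB.
apply: (@product_measure_unique _ _ _ _ _ PA PB nu) => // E F mE mF.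
rewrite nuX; last exact: measurableX.
transitivity (P (A @^-1` E) * P (B @^-1` F))%E => //.
rewrite !ginibre_law// -ge0_integralZr//; last 3 first.
- by apply/measurable_EFinP; exact: measurable_funTS.
- by move=> M _; rewrite lee_fin gauss_ge0.
- by apply: integral_ge0 => M _; rewrite lee_fin gauss_ge0.
rewrite integral_mkcond; apply: eq_integral => M _; rewrite patchE.
case: ifPn => ME; last first.
  rewrite integral0_eq// => M' _; rewrite indicE memNset ?mul0r//= => -[h _].
  by move: ME; rewrite mem_set.
rewrite -ge0_integralZl//.
- rewrite integral_mkcond; apply: eq_integral => M' _; rewrite patchE indicE in_setX ME/=.
  by case: ifP => _; rewrite ?mul1r ?mul0r// EFinM.
- by apply/measurable_EFinP; exact: measurable_funTS.
- by move=> M' _; rewrite lee_fin gauss_ge0.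
- by rewrite lee_fin gauss_ge0.
Qed.

End ginibre.

(** Change of variables from [B] to [Y] at a fixed [A]; left multiplication acts on each of the [n]
    columns, whence the exponent of the determinant. *)
Lemma integral_quotient_gauss {R : realType} n (E : set 'M[R]_n) (A : 'M[R]_n) :
  measurable E -> A \in unitmx ->
  (\int[lebesgue_mx]_B (\1_E (invmx A *m B) * (gauss A * gauss B))%:E =
   \int[lebesgue_mx]_Y (\1_E Y * (`|\det A| ^+ n * (gauss A * gauss (A *m Y))))%:E)%E.
Proof.
move=> mE uA.
have mid := @measurable_id _ 'M[R]_n setT.
have mm (C : 'M[R]_n) : measurable_fun setT (fun B : 'M[R]_n => C *m B).
  by apply: measurable_mulmx => //; exact: measurable_cst.
have mI : measurable_fun setT (\1_E : 'M[R]_n -> R) by exact: measurable_indic.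
have mg := @measurable_gauss R n n.
have I0 B : 0 <= \1_E B * (gauss A * gauss (A *m B)) by rewrite !mulr_ge0// gauss_ge0.
rewrite (integral_mulmxl (f := fun B => (\1_E (invmx A *m B) * (gauss A * gauss B))%:E) uA).
- rewrite -ge0_integralZl//.
  + by apply: eq_integral => Y _; rewrite mulKmx// -EFinM mulrCA.
  + under eq_fun do rewrite mulKmx//.
    apply/measurable_EFinP/measurable_funM => //; apply: measurable_funM; first exact: measurable_cst.
    exact: (measurableT_comp mg (mm A)).
  + by move=> Y _; rewrite mulKmx// lee_fin.
- apply/measurable_EFinP/measurable_funM; first exact: (measurableT_comp mI (mm _)).
  by apply: measurable_funM => //; exact: measurable_cst.
- by move=> M; rewrite lee_fin !mulr_ge0// gauss_ge0.
Qed.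

Theorem proposition6p5 (R : realType) (d : measure_display)
    (T : measurableType d) (P : probability T R) (N : nat)
    (A B : {RV P >-> 'M[R]_N})
    (hA : real_ginibre P A) (hB : real_ginibre P B)
    (hAB : independent P A B) :
  has_density P (fun w => invmx (A w) *m B w) lebesgue_mx
    (fun Y : 'M[R]_N =>
       pi `^ (- (N%:R ^+ 2 / 2)) *
       (\prod_(0 <= j < N)
          (Gamma ((N%:R + 1) / 2 + j%:R / 2) / Gamma ((j%:R + 1) / 2))) *
       (\det (1%:M + Y *m Y^T)) ^- N).
Proof.
have mA : measurable_fun setT A by exact: measurable_funPT.
have mB : measurable_fun setT B by exact: measurable_funPT.
have mid := @measurable_id _ 'M[R]_N setT.
have mg := @measurable_gauss R N N.
split.
- by apply: measurable_mulmx => //; exact: measurable_invmx.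
- apply: measurable_funM; first exact: measurable_cst.
  apply: measurable_invr; apply: measurable_funX; apply: measurable_det.
  apply: measurable_addmx; first exact: measurable_cst.
  by apply: measurable_mulmx => //; exact: measurable_trmx.
- move=> Y; rewrite !mulr_ge0 ?powR_ge0 ?invr_ge0 ?exprn_ge0 ?(ltW (det_one_plus_gram_gt0 _))//.
  (* All Gamma arguments are halves of positive integers, so the values are positive. *)
  apply: prodr_ge0 => j _; rewrite divr_ge0// -?mulrDl ltW//.
    by rewrite (_ : N%:R + 1 + j%:R = (N + j).+1%:R) ?Gamma_half_gt0// -natr1 natrD addrAC.
  by rewrite natr1 Gamma_half_gt0.
move=> E mE.
have mI : measurable_fun setT (\1_E : 'M[R]_N -> R) by exact: measurable_indic.
have m1 := @measurable_fst _ _ 'M[R]_N 'M[R]_N.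
have m2 := @measurable_snd _ _ 'M[R]_N 'M[R]_N.
have mq : measurable_fun setT (fun p : 'M[R]_N * 'M[R]_N => invmx p.1 *m p.2).
  by apply: measurable_mulmx => //; exact: measurable_invmx.
pose Z := (fun p : 'M[R]_N * 'M[R]_N => invmx p.1 *m p.2) @^-1` E.
have mZ : measurable Z by rewrite -[X in measurable X]setTI; exact: mq.
transitivity (P ((fun w => (A w, B w)) @^-1` Z)) => //.
rewrite (ginibre_pair_law hA hB hAB mZ).
pose G (p : 'M[R]_N * 'M[R]_N) :=
  (\1_E p.2 * (`|\det p.1| ^+ N * (gauss p.1 * gauss (p.1 *m p.2))))%:E.
have mG : measurable_fun setT G.
  apply/measurable_EFinP/measurable_funM; first exact: (measurableT_comp mI m2).
  apply: measurable_funM.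
    apply: measurable_funX; apply: (measurableT_comp (@normr_measurable R setT)).
    exact: measurable_det.
  apply: measurable_funM; first exact: (measurableT_comp mg m1).
  have mm : measurable_fun setT (fun p : 'M[R]_N * 'M[R]_N => p.1 *m p.2).
    exact: measurable_mulmx.
  exact: (measurableT_comp mg mm).
have G0 p : (0 <= G p)%E.
  by rewrite lee_fin !mulr_ge0 ?exprn_ge0// gauss_ge0.
pose H (p : 'M[R]_N * 'M[R]_N) := (\1_Z p * (gauss p.1 * gauss p.2))%:E.
have mH : measurable_fun setT H.
  apply/measurable_EFinP/measurable_funM; first exact: measurable_indic.
  by apply: measurable_funM; [exact: (measurableT_comp mg m1)|exact: (measurableT_comp mg m2)].
have H0 p : (0 <= H p)%E by rewrite lee_fin !mulr_ge0// gauss_ge0.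
transitivity (\int[lebesgue_mx]_M \int[lebesgue_mx]_Y G (M, Y))%E.
  apply: ge0_ae_eq_integral => //.
  - exact: (measurable_fun_fubini_tonelli_F (m2 := @lebesgue_mx R N N) H mH H0).
  - exact: (measurable_fun_fubini_tonelli_F (m2 := @lebesgue_mx R N N) G mG G0).
  - by move=> M _; apply: integral_ge0 => Y _; exact: H0.
  - by move=> M _; apply: integral_ge0 => Y _; exact: G0.
  (* The substitution requires an invertible matrix; the singular ones form a Lebesgue null set. *)
  - have [K [mK K0 hK]] := @ae_det_neq0 R N.
    exists K; split => // M /= hM; apply: hK => /= dM; apply: hM => _.
    by rewrite -integral_quotient_gauss// unitmxE unitfE.
(* Exchanging the integrals puts [Y] outside, and the inner integral becomes that of
   [integral_det_gauss_mul]. *)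
rewrite (fubini_tonelli (m1 := @lebesgue_mx R N N) (m2 := @lebesgue_mx R N N) G mG G0).
rewrite [RHS]integral_mkcond; apply: eq_integral => Y _; rewrite patchE /G/=.
case: ifPn => YE; last first.
  by rewrite integral0_eq// => M _; rewrite indicE (negbTE YE) mul0r.
under eq_integral do rewrite indicE YE mul1r.
by rewrite integral_det_gauss_mul density_constant.
Qed.
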